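(* Let $P$ be a finite poset of rank $r$ such that $\mathcal{F}(P)$ is Cohen-Macaulay, and let $[r]=\{1,\ldots,r\}$. (1) If $P$ is graded then for any subset $S=\{i,i+1,\ldots,i+j\}$ of $[r]$, the partial flag ideal $\mathcal{F}(P,S)$ is Cohen-Macaulay. (2) If $P$ is pure then for any subset $S\subseteq[r]$, $\mathcal{F}(P,S)$ is Cohen-Macaulay.
   Context: Let $\Bbbk$ be a field. A finite poset $P$ is graded if it has a rank function $r_P:P\to\mathbb{N}$ with $r_P(p)=1$ for every minimal element $p$ and $r_P(q)=r_P(p)+1$ whenever $q$ covers $p$; the rank of $P$ is $\max\{r_P(p): p\in P\}$. $P$ is pure if all its maximal elements have the same rank (equivalently, all maximal chains have the same length). The flag ideal $\mathcal{F}(P)\subseteq\Bbbk[x_p: p\in P]$ is generated by all monomials $x_{p_1}\cdots x_{p_n}$ with $p_1<\cdots<p_n$ a maximal chain of $P$. For $S\subseteq[r]$, $P_S$ is the induced subposet of $P$ on $\{p\in P: r_P(p)\in S\}$ and $\mathcal{F}(P,S)=\mathcal{F}(P_S)\subseteq\Bbbk[x_p:p\in P_S]$. An ideal $I$ of a polynomial ring $R$ is called Cohen-Macaulay if $R/I$ is a Cohen-Macaulay ring. *)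

(* Defs.v *)
From HB Require Import structures.
From mathcomp Require Import all_boot all_order all_algebra generic_quotient.
From mathcomp Require Import mpoly boolp classical_sets.
From mathcomp Require Import ring.

Set Implicit Arguments.
Unset Strict Implicit.
Unset Printing Implicit Defensive.

Import Order.TTheory GRing.Theory.

Local Open Scope classical_set_scope.
Local Open Scope ring_scope.
Local Open Scope quotient_scope.

(* Rings are commutative and possibly zero (comPzRingType): the unit ideal has *)
(* a quotient too, and the zero ring is Cohen-Macaulay since it has no primes. *)

Section Ideals.
Variable A : comPzRingType.
Implicit Types (I J G : set A) (s : seq A).

Definition is_ideal I :=
  [/\ I 0, forall x y, I x -> I y -> I (x + y) & forall a x, I x -> I (a * x)].

Record ideal := Ideal { ideal_set :> A -> Prop ; idealP : is_ideal ideal_set }.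

Definition ideal_gen G : set A := [set x | exists cs : seq (A * A),
  (forall c, c \in cs -> G c.2) /\ x = \sum_(c <- cs) c.1 * c.2].

Lemma ideal_genP G : is_ideal (ideal_gen G).
Proof.
split=> [|x y [cs [hcs ->]] [ds [hds ->]]|a x [cs [hcs ->]]].
- by exists [::]; rewrite big_nil.
- exists (cs ++ ds); rewrite big_cat; split=> // c.
  by rewrite mem_cat => /orP[/hcs|/hds].
- exists [seq (a * c.1, c.2) | c <- cs]; split=> [c /mapP[e /hcs ? ->] //|].
  by rewrite big_map mulr_sumr; apply: eq_bigr => c _; rewrite mulrA.
Qed.

Definition gen_ideal G := Ideal (ideal_genP G).

Definition is_prime_ideal I :=
  [/\ is_ideal I, ~ I 1 & forall x y, I (x * y) -> I x \/ I y].

Record primeIdeal := PrimeIdeal { prime_set :> A -> Prop ; primeP : is_prime_ideal prime_set }.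

Definition is_maximal_ideal I :=
  [/\ is_ideal I, ~ I 1 & forall J, is_ideal J -> ~ J 1 -> I `<=` J -> J = I].

Definition noetherian :=
  forall I, is_ideal I -> exists s, I = ideal_gen [set` s].

End Ideals.

Section QuotientRing.
Variables (A : comPzRingType) (I : ideal A).

Lemma ideal0 : I 0. Proof. by case: (idealP I). Qed.
Lemma idealD x y : I x -> I y -> I (x + y). Proof. by case: (idealP I) => _ + _; exact. Qed.
Lemma idealM a x : I x -> I (a * x). Proof. by case: (idealP I) => _ _; exact. Qed.

Definition quo_equiv (x y : A) := `[< I (x - y) >].

Lemma quo_equiv_class : equiv_class_of quo_equiv.
Proof.
split=> [x|x y|y x z]; rewrite /quo_equiv.
- by apply/asboolP; rewrite subrr; exact: ideal0.
- by apply/asboolP/asboolP => /(idealM (-1)); rewrite mulN1r opprB.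
- by move=> /asboolP xy /asboolP yz; apply/asboolP; rewrite -(subrKA y); exact: idealD.
Qed.

Canonical quo_equiv_rel := EquivRelPack quo_equiv_class.
Canonical quo_encModRel := defaultEncModRel quo_equiv.

Definition quo := {eq_quot quo_equiv}.
HB.instance Definition _ : EqQuotient A quo_equiv quo := EqQuotient.on quo.
HB.instance Definition _ := Choice.on quo.

Lemma quo_eqP (x y : A) : reflect (I (x - y)) (x == y %[mod quo]).
Proof. by rewrite piE; exact: asboolP. Qed.

Lemma quo_repr (x : A) : I (repr (\pi_quo x) - x).
Proof. by apply/quo_eqP; rewrite reprK. Qed.

Definition quo_zero : quo := lift_cst quo 0.
Definition quo_one : quo := lift_cst quo 1.
Definition quo_add := lift_op2 quo +%R.
Definition quo_opp := lift_op1 quo -%R.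
Definition quo_mul := lift_op2 quo *%R.

Canonical quo_zero_morph := PiConst quo_zero.
Canonical quo_one_morph := PiConst quo_one.

Lemma quo_pi_opp : {morph \pi : x / - x >-> quo_opp x}.
Proof.
move=> x; unlock quo_opp; apply/eqP/quo_eqP; rewrite opprK addrC.
exact: quo_repr.
Qed.
Canonical quo_opp_morph := PiMorph1 quo_pi_opp.

Lemma quo_pi_add : {morph \pi : x y / x + y >-> quo_add x y}.
Proof.
move=> x y; unlock quo_add; apply/esym/eqP/quo_eqP; rewrite opprD addrACA.
by apply: idealD; exact: quo_repr.
Qed.
Canonical quo_add_morph := PiMorph2 quo_pi_add.

Lemma quo_pi_mul : {morph \pi : x y / x * y >-> quo_mul x y}.
Proof.
move=> x y; unlock quo_mul; apply/esym/eqP/quo_eqP.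
set x' := repr _; set y' := repr _.
have -> : x' * y' - x * y = y' * (x' - x) + x * (y' - y) by ring.
by apply: idealD; apply: idealM; exact: quo_repr.
Qed.
Canonical quo_mul_morph := PiMorph2 quo_pi_mul.

Lemma quo_addA : associative quo_add.
Proof. by move=> x y z; rewrite -[x]reprK -[y]reprK -[z]reprK !piE addrA. Qed.
Lemma quo_addC : commutative quo_add.
Proof. by move=> x y; rewrite -[x]reprK -[y]reprK !piE addrC. Qed.
Lemma quo_add0 : left_id quo_zero quo_add.
Proof. by move=> x; rewrite -[x]reprK !piE add0r. Qed.
Lemma quo_addN : left_inverse quo_zero quo_opp quo_add.
Proof. by move=> x; rewrite -[x]reprK !piE addNr. Qed.
HB.instance Definition _ :=
  GRing.isZmodule.Build quo quo_addA quo_addC quo_add0 quo_addN.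

Lemma quo_mulA : associative quo_mul.
Proof. by move=> x y z; rewrite -[x]reprK -[y]reprK -[z]reprK !piE mulrA. Qed.
Lemma quo_mulC : commutative quo_mul.
Proof. by move=> x y; rewrite -[x]reprK -[y]reprK !piE mulrC. Qed.
Lemma quo_mul1 : left_id quo_one quo_mul.
Proof. by move=> x; rewrite -[x]reprK !piE mul1r. Qed.
Lemma quo_mulD : left_distributive quo_mul quo_add.
Proof.
by move=> x y z; rewrite -[x]reprK -[y]reprK -[z]reprK !piE mulrDl.
Qed.
HB.instance Definition _ :=
  GRing.Zmodule_isComPzRing.Build quo quo_mulA quo_mulC quo_mul1 quo_mulD.

End QuotientRing.

Section Localization.
Variables (A : comPzRingType) (p : primeIdeal A).

Definition denom := {s : A | `[< ~ p s >]}.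
HB.instance Definition _ := SubChoice.on denom.

Lemma denomP (s : denom) : ~ p (sval s). Proof. by apply/asboolP/(valP s). Qed.

Lemma denom1_subproof : `[< ~ p 1 >].
Proof. by apply/asboolP; case: (primeP p). Qed.
Definition denom1 : denom := exist (fun s : A => `[< ~ p s >]) 1 denom1_subproof.

Lemma notin_primeM (s t : A) : ~ p s -> ~ p t -> ~ p (s * t).
Proof. by case: (primeP p) => _ _ pM ps pt /pM[]. Qed.

Lemma denomM_subproof (s t : denom) : `[< ~ p (sval s * sval t) >].
Proof. by apply/asboolP/notin_primeM; exact: denomP. Qed.
Definition denomM (s t : denom) : denom :=
  exist (fun s : A => `[< ~ p s >]) _ (denomM_subproof s t).

(* the pair (a, s) stands for the fraction a / s *)
Definition frac := (A * denom)%type.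
HB.instance Definition _ := Choice.on frac.

Definition loc_eq (x y : frac) :=
  exists u : denom, sval u * (x.1 * sval y.2 - y.1 * sval x.2) = 0.
Definition loc_equiv (x y : frac) := `[< loc_eq x y >].

Lemma loc_equiv_class : equiv_class_of loc_equiv.
Proof.
split=> [x|x y|y x z]; rewrite /loc_equiv.
- by apply/asboolP; exists denom1; rewrite subrr mulr0.
- by apply/asboolP/asboolP => -[u hu]; exists u; rewrite -opprB mulrN hu oppr0.
- move=> /asboolP[u hu] /asboolP[v hv]; apply/asboolP.
  exists (denomM (denomM u v) y.2) => /=.
  transitivity (sval v * sval z.2 * (sval u * (x.1 * sval y.2 - y.1 * sval x.2))
              + sval u * sval x.2 * (sval v * (y.1 * sval z.2 - z.1 * sval y.2))).
    by ring.
  by rewrite hu hv !mulr0 addr0.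
Qed.

Canonical loc_equiv_rel := EquivRelPack loc_equiv_class.
Canonical loc_encModRel := defaultEncModRel loc_equiv.

Definition loc := {eq_quot loc_equiv}.
HB.instance Definition _ : EqQuotient frac loc_equiv loc := EqQuotient.on loc.
HB.instance Definition _ := Choice.on loc.

Lemma loc_eqP (x y : frac) : reflect (loc_eq x y) (x == y %[mod loc]).
Proof. by rewrite piE; exact: asboolP. Qed.

Lemma loc_repr (x : frac) : loc_eq (repr (\pi_loc x)) x.
Proof. by apply/loc_eqP; rewrite reprK. Qed.

Definition frac_add (x y : frac) : frac :=
  (x.1 * sval y.2 + y.1 * sval x.2, denomM x.2 y.2).
Definition frac_opp (x : frac) : frac := (- x.1, x.2).
Definition frac_mul (x y : frac) : frac := (x.1 * y.1, denomM x.2 y.2).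

Definition loc_zero : loc := lift_cst loc (0, denom1).
Definition loc_one : loc := lift_cst loc (1, denom1).
Definition loc_add := lift_op2 loc frac_add.
Definition loc_opp := lift_op1 loc frac_opp.
Definition loc_mul := lift_op2 loc frac_mul.

Canonical loc_zero_morph := PiConst loc_zero.
Canonical loc_one_morph := PiConst loc_one.

Lemma loc_pi_opp : {morph \pi : x / frac_opp x >-> loc_opp x}.
Proof.
move=> x; unlock loc_opp; apply/esym/eqP/loc_eqP.
have [u hu] := loc_repr x; exists u => /=.
by rewrite !mulNr -opprD mulrN hu oppr0.
Qed.
Canonical loc_opp_morph := PiMorph1 loc_pi_opp.

Lemma loc_pi_add : {morph \pi : x y / frac_add x y >-> loc_add x y}.
Proof.
move=> x y; unlock loc_add; apply/esym/eqP/loc_eqP.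
have [u hu] := loc_repr x; have [v hv] := loc_repr y.
set x' := repr _ in hu *; set y' := repr _ in hv *.
exists (denomM u v) => /=.
transitivity
  (sval v * sval y.2 * sval y'.2 * (sval u * (x'.1 * sval x.2 - x.1 * sval x'.2))
   + sval u * sval x.2 * sval x'.2 * (sval v * (y'.1 * sval y.2 - y.1 * sval y'.2))).
  by ring.
by rewrite hu hv !mulr0 addr0.
Qed.
Canonical loc_add_morph := PiMorph2 loc_pi_add.

Lemma loc_pi_mul : {morph \pi : x y / frac_mul x y >-> loc_mul x y}.
Proof.
move=> x y; unlock loc_mul; apply/esym/eqP/loc_eqP.
have [u hu] := loc_repr x; have [v hv] := loc_repr y.
set x' := repr _ in hu *; set y' := repr _ in hv *.
exists (denomM u v) => /=.
transitivity
  (sval v * y'.1 * sval y.2 * (sval u * (x'.1 * sval x.2 - x.1 * sval x'.2))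
   + sval u * x.1 * sval x'.2 * (sval v * (y'.1 * sval y.2 - y.1 * sval y'.2))).
  by ring.
by rewrite hu hv !mulr0 addr0.
Qed.
Canonical loc_mul_morph := PiMorph2 loc_pi_mul.

Lemma loc_pi_ext (x y : frac) :
  x.1 * sval y.2 = y.1 * sval x.2 -> x = y %[mod loc].
Proof.
by move=> xy; apply/eqP/loc_eqP; exists denom1; rewrite xy subrr mulr0.
Qed.

Lemma loc_addA : associative loc_add.
Proof.
move=> x y z; rewrite -[x]reprK -[y]reprK -[z]reprK !piE.
by apply: loc_pi_ext => /=; ring.
Qed.
Lemma loc_addC : commutative loc_add.
Proof.
move=> x y; rewrite -[x]reprK -[y]reprK !piE.
by apply: loc_pi_ext => /=; ring.
Qed.
Lemma loc_add0 : left_id loc_zero loc_add.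
Proof.
by move=> x; rewrite -[x]reprK !piE; apply: loc_pi_ext => /=; ring.
Qed.
Lemma loc_addN : left_inverse loc_zero loc_opp loc_add.
Proof.
by move=> x; rewrite -[x]reprK !piE; apply: loc_pi_ext => /=; ring.
Qed.
HB.instance Definition _ :=
  GRing.isZmodule.Build loc loc_addA loc_addC loc_add0 loc_addN.

Lemma loc_mulA : associative loc_mul.
Proof.
move=> x y z; rewrite -[x]reprK -[y]reprK -[z]reprK !piE.
by apply: loc_pi_ext => /=; ring.
Qed.
Lemma loc_mulC : commutative loc_mul.
Proof.
move=> x y; rewrite -[x]reprK -[y]reprK !piE.
by apply: loc_pi_ext => /=; ring.
Qed.
Lemma loc_mul1 : left_id loc_one loc_mul.
Proof.
by move=> x; rewrite -[x]reprK !piE; apply: loc_pi_ext => /=; ring.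
Qed.
Lemma loc_mulD : left_distributive loc_mul loc_add.
Proof.
move=> x y z; rewrite -[x]reprK -[y]reprK -[z]reprK !piE.
by apply: loc_pi_ext => /=; ring.
Qed.
HB.instance Definition _ :=
  GRing.Zmodule_isComPzRing.Build loc loc_mulA loc_mulC loc_mul1 loc_mulD.

End Localization.

Section CohenMacaulay.

Definition prime_chain (A : comPzRingType) (n : nat) (q : nat -> set A) :=
  (forall i, (i <= n)%N -> is_prime_ideal (q i)) /\
  (forall i, (i < n)%N -> q i `<` q i.+1).

(* Both invariants are relations with a natural number: they are finite for a *)
(* Noetherian local ring.                                                     *)
Definition has_krull_dim (A : comPzRingType) (n : nat) :=
  (exists q : nat -> set A, prime_chain n q) /\
  (forall m (q : nat -> set A), prime_chain m q -> (m <= n)%N).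

Definition regular_sequence (A : comPzRingType) (s : seq A) :=
  (forall i a, (i < size s)%N ->
    ideal_gen [set` take i s] (a * s`_i) -> ideal_gen [set` take i s] a) /\
  ~ ideal_gen [set` s] 1.

Definition has_depth (A : comPzRingType) (m : set A) (n : nat) :=
  (exists s : seq A, [/\ regular_sequence s, [set` s] `<=` m & size s = n]) /\
  (forall s : seq A, regular_sequence s -> [set` s] `<=` m -> (size s <= n)%N).

Definition cohen_macaulay_local (A : comPzRingType) :=
  noetherian A /\ exists m : set A,
    [/\ is_maximal_ideal m, forall m', is_maximal_ideal m' -> m' = m
      & exists n, has_krull_dim A n /\ has_depth m n].

Definition cohen_macaulay_ring (A : comPzRingType) :=
  noetherian A /\ forall p : primeIdeal A, cohen_macaulay_local (loc p).

Definition cohen_macaulay (R : comPzRingType) (I : ideal R) :=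
  cohen_macaulay_ring (quo I).

End CohenMacaulay.

Section Posets.
Context {d : Order.disp_t} {P : finPOrderType d}.
Implicit Types (p q : P) (C : {set P}).

Definition minimal p := forall q, ~~ (q < p)%O.
Definition maximal p := forall q, ~~ (p < q)%O.
Definition covers q p := (p < q)%O /\ forall z, ~~ ((p < z)%O && (z < q)%O).

Definition is_rank_function (rk : P -> nat) :=
  (forall p, minimal p -> rk p = 1%N) /\
  (forall p q, covers q p -> rk q = (rk p).+1).

Definition poset_rank (rk : P -> nat) := (\max_(p : P) rk p)%N.

Definition is_pure (rk : P -> nat) :=
  is_rank_function rk /\
  forall p q, maximal p -> maximal q -> rk p = rk q.

Definition is_chain C := [forall p in C, forall q in C, (p >=< q)%O].
Definition is_maximal_chain C := maxset is_chain C.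

End Posets.

Section FlagIdeals.
Variable k : fieldType.

(* The variable x_p is 'X_(enum_rank p). *)
Definition chain_monomial d (P : finPOrderType d) (C : {set P}) : {mpoly k[#|P|]} :=
  \prod_(p in C) 'X_(enum_rank p).

Definition flag_ideal d (P : finPOrderType d) : ideal {mpoly k[#|P|]} :=
  gen_ideal [set f | exists2 C : {set P}, is_maximal_chain C & f = chain_monomial C].

End FlagIdeals.

Definition rank_selected d (P : finPOrderType d) (rk : P -> nat) (S : {pred nat}) :=
  {p : P | rk p \in S}.

Section RankSelected.
Variables (d : Order.disp_t) (P : finPOrderType d) (rk : P -> nat) (S : {pred nat}).
HB.instance Definition _ := Finite.on (rank_selected rk S).
HB.instance Definition _ := SubChoice.on (rank_selected rk S).
HB.instance Definition _ := [SubChoice_isSubPOrder of rank_selected rk S by <: with d].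
End RankSelected.

Definition partial_flag_ideal (k : fieldType) d (P : finPOrderType d)
    (rk : P -> nat) (S : {pred nat}) : ideal {mpoly k[#|{: rank_selected rk S}|]} :=
  flag_ideal k (rank_selected rk S).

(* Main.v *)
(* Let V be the set of maximal elements of P lying below all the selected      *)
(* ranks and T the set of elements outside V with unselected rank. Setting the *)
(* variables of T to 1 turns F(P) into F(P_S) plus the variables of V, so that *)
(* R_S/F(P_S) is the quotient of R/F(P) by the elements x_t - 1, t in T. These *)
(* form a regular sequence because F(P) is a monomial ideal, and the quotient  *)
(* of a Cohen-Macaulay ring by a regular sequence is Cohen-Macaulay: after     *)
(* localising, the depth drops by exactly the length of the sequence           *)
(* (exchange of regular sequences), the dimension drops by at least as much,   *)
(* and depth never exceeds dimension.                                          *)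

Require Import Defs.
From HB Require Import structures.
From mathcomp Require Import all_boot all_order all_algebra generic_quotient.
From mathcomp Require Import mpoly boolp classical_sets.
From mathcomp Require Import ring zify.

Set Implicit Arguments.
Unset Strict Implicit.
Unset Printing Implicit Defensive.

Import Order.TTheory GRing.Theory.

(** Setting an unselected variable x_p to 1 erases p from all chain monomials. This is harmless
    except when a maximal chain meets no selected rank: its monomial would become 1. Keeping the
    variables of the set [V] of maximal elements below all selected ranks prevents this: such a
    chain leaves the single variable x_p of its top, which is then 0 in the quotient. Three
    ingredients make this work.

    Combinatorics: a maximal chain of P has an element of every rank up to that of its top
    ([maximal_chain_rank]). So it either ends in [V] or restricts to a maximal chain of P_S
    ([chain_restr]), provided every maximal element of P lies in [V], has selected rank, or has rank
    at least all selected ranks. An interval S in a graded poset and any S in a pure poset satisfy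
    this.

    Monomials: membership in a monomial ideal is decided on supports, so x_p - 1 is a nonzerodivisor
    modulo it ([regular_mod_monomial]). Setting variables to 1 gives a monomial ideal again
    ([adjoins_set_one]), so the elements x_p - 1 form a regular sequence, and dividing R/F(P) by it
    yields R_S/F(P_S) ([restr_kernel]).

    Commutative algebra: Cohen-Macaulayness passes to the quotient by a regular sequence
    ([cohen_macaulay_ring_surj]). After localizing, depth is controlled by exchanging elements of
    regular sequences ([regular_seq_exchange]), and dimension by inserting primes below a prime that
    contains a regular sequence ([prime_chain_regular_seq]). *)

Local Open Scope nat_scope.

(** * Ideals and regular sequences modulo an ideal *)

Section IdealTheory.
Local Open Scope classical_set_scope.
Local Open Scope ring_scope.
Variable A : comPzRingType.
Implicit Types (I J : set A) (x y a f : A) (s : seq A).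

Lemma is_ideal0 I : is_ideal I -> I 0. Proof. by case. Qed.
Lemma is_idealD I x y : is_ideal I -> I x -> I y -> I (x + y).
Proof. by case=> _ + _; exact. Qed.
Lemma is_idealM I a x : is_ideal I -> I x -> I (a * x).
Proof. by case=> _ _; exact. Qed.
Lemma is_idealMr I a x : is_ideal I -> I x -> I (x * a).
Proof. by rewrite mulrC; exact: is_idealM. Qed.
Lemma is_idealB I x y : is_ideal I -> I x -> I y -> I (x - y).
Proof. by move=> hI Ix Iy; rewrite -mulN1r; apply: is_idealD => //; apply: is_idealM. Qed.
Lemma is_ideal_sum I (T : Type) (r : seq T) (P : pred T) (F : T -> A) :
  is_ideal I -> (forall i, P i -> I (F i)) -> I (\sum_(i <- r | P i) F i).
Proof.
move=> hI hF; apply: big_ind => [|x y|//]; first exact: is_ideal0.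
exact: is_idealD.
Qed.

Lemma is_ideal_zero : is_ideal [set (0 : A)].
Proof. by split=> //= [x y -> ->|a x ->]; rewrite ?addr0 ?mulr0. Qed.

Lemma ideal_gen_incl (G : set A) : G `<=` ideal_gen G.
Proof.
move=> x Gx; exists [:: (1, x)]; rewrite big_seq1 mul1r; split=> // c.
by rewrite inE => /eqP ->.
Qed.

Lemma ideal_gen_min (G I : set A) : is_ideal I -> G `<=` I -> ideal_gen G `<=` I.
Proof.
move=> hI GI x [cs [hcs ->]]; rewrite big_seq; apply: is_ideal_sum => // c /hcs Gc.
by apply: is_idealM => //; exact: GI.
Qed.

(** The ideal I + (x). Enlarging I replaces passing to successive quotient rings. *)
Definition adjoin I x : set A := [set y | exists a, I (y - a * x)].

Lemma is_ideal_adjoin I x : is_ideal I -> is_ideal (adjoin I x).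
Proof.
move=> hI; split=> [|y z [a ha] [b hb]|a y [b hb]].
- by exists 0; rewrite mul0r subr0; exact: is_ideal0.
- exists (a + b); have -> : y + z - (a + b) * x = (y - a * x) + (z - b * x) by ring.
  exact: is_idealD.
- exists (a * b); have -> : a * y - a * b * x = a * (y - b * x) by ring.
  exact: is_idealM.
Qed.

Lemma sub_adjoin I x : I `<=` adjoin I x.
Proof. by move=> y Iy; exists 0; rewrite mul0r subr0. Qed.

Lemma mem_adjoin I x : is_ideal I -> adjoin I x x.
Proof. by move=> hI; exists 1; rewrite mul1r subrr; exact: is_ideal0. Qed.

Lemma adjoin_min I J x : is_ideal J -> I `<=` J -> J x -> adjoin I x `<=` J.
Proof.
move=> hJ IJ Jx y [a /IJ]; rewrite -{2}(subrK (a * x) y) => h.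
by apply: is_idealD => //; exact: is_idealM.
Qed.

Lemma adjoinC I x y : is_ideal I -> adjoin (adjoin I x) y = adjoin (adjoin I y) x.
Proof.
move=> hI; wlog suff h : x y / adjoin (adjoin I x) y `<=` adjoin (adjoin I y) x.
  by apply/seteqP; split; exact: h.
move=> z [a [b h]]; exists b; exists a.
by have -> : z - b * x - a * y = z - a * y - b * x by ring.
Qed.

Definition regular_mod I x := forall a, I (a * x) -> I a.

(** A weakly regular sequence on A/I: properness of the generated ideal is kept apart and returns in
    [regular_sequenceP]. *)
Fixpoint regular_seq_mod I s :=
  if s is x :: s' then regular_mod I x /\ regular_seq_mod (adjoin I x) s' else True.

Definition adjoins I s := foldl adjoin I s.

Lemma is_ideal_adjoins I s : is_ideal I -> is_ideal (adjoins I s).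
Proof. by elim: s I => //= x s IH I hI; apply/IH/is_ideal_adjoin. Qed.

Lemma sub_adjoins I s : I `<=` adjoins I s.
Proof. by elim: s I => [|x s IH] I y Iy //=; apply: IH; exact: sub_adjoin. Qed.

Lemma mem_adjoins I s : is_ideal I -> [set` s] `<=` adjoins I s.
Proof.
elim: s I => //= x s IH I hI y /=; rewrite inE => /orP[/eqP->|].
  by apply: sub_adjoins; exact: mem_adjoin.
by apply/IH/is_ideal_adjoin.
Qed.

Lemma adjoins_min I J s :
  is_ideal J -> I `<=` J -> [set` s] `<=` J -> adjoins I s `<=` J.
Proof.
elim: s I => //= x s IH I hJ IJ sJ; apply: IH => //.
  by apply: adjoin_min => //; apply: sJ => /=; rewrite mem_head.
by move=> y /= ys; apply: sJ => /=; rewrite inE ys orbT.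
Qed.

Lemma adjoins_gen s : adjoins [set 0] s = ideal_gen [set` s].
Proof.
apply/seteqP; split.
  apply: adjoins_min; [exact: ideal_genP| |exact: ideal_gen_incl].
  by move=> x ->; apply: is_ideal0; exact: ideal_genP.
by apply: ideal_gen_min; [apply: is_ideal_adjoins|apply: mem_adjoins];
  exact: is_ideal_zero.
Qed.

Lemma regular_seq_mod_cat I s1 s2 : regular_seq_mod I (s1 ++ s2) <->
  regular_seq_mod I s1 /\ regular_seq_mod (adjoins I s1) s2.
Proof. by elim: s1 I => /= [|x s1 IH] I; rewrite ?IH; tauto. Qed.

Lemma regular_seq_modP I s : regular_seq_mod I s <->
  forall i, (i < size s)%N -> regular_mod (adjoins I (take i s)) s`_i.
Proof.
elim: s I => //= x s IH I; rewrite IH; split=> [[h0 h] [|i] //|h].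
  exact: h.
by split=> [|i hi]; [exact: (h 0%N)|exact: (h i.+1)].
Qed.

Lemma regular_sequenceP s : regular_sequence s <->
  regular_seq_mod [set 0] s /\ ~ adjoins [set 0] s 1.
Proof.
rewrite /regular_sequence regular_seq_modP -adjoins_gen.
split=> -[h h1]; split=> // i.
  by move=> hi a; rewrite adjoins_gen; exact: h.
by move=> a hi; rewrite -adjoins_gen; exact: h.
Qed.

(** If a x = b y modulo I, regularity of y modulo I + (x) gives b = c x modulo I; then x kills a - c
    y modulo I, so a lies in I + (y). *)
Lemma regular_mod_swap I x y : is_ideal I -> regular_mod I x -> regular_mod I y ->
  regular_mod (adjoin I x) y -> regular_mod (adjoin I y) x.
Proof.
move=> hI rx ry rxy a [b hb].
have /rxy[c hc] : adjoin I x (b * y).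
  by exists a; rewrite -opprB -mulN1r; exact: is_idealM.
exists c; apply: rx.
have -> : (a - c * y) * x = (a * x - b * y) + y * (b - c * x) by ring.
by apply: is_idealD => //; exact: is_idealM.
Qed.

Lemma regular_seq_mod_swap I x y s : is_ideal I -> regular_mod I y ->
  regular_seq_mod I (x :: y :: s) -> regular_seq_mod I (y :: x :: s).
Proof.
move=> hI ry [rx [rxy h]]; split=> //=; split; first exact: regular_mod_swap.
by rewrite adjoinC.
Qed.

End IdealTheory.

(** * Prime ideals *)

Section Primes.
Local Open Scope classical_set_scope.
Local Open Scope ring_scope.
Variable A : comPzRingType.
Implicit Types (I J p : set A) (x y a f : A) (s : seq A).

(** Zorn's lemma: the union of a chain of ideals is finitely generated, its generators lie in one
    member, so the union equals that member. *)
Lemma noetherian_max (F : set (set A)) : noetherian A ->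
  (forall I, F I -> is_ideal I) -> forall I, F I ->
  exists J, [/\ F J, I `<=` J & forall J', F J' -> J `<=` J' -> J' = J].
Proof.
move=> nA hF I FI.
pose P X := X = set0 \/ (F X /\ I `<=` X).
have ne X : F X -> X !=set0 by move=> /hF hX; exists 0; exact: is_ideal0.
have [J [PJ hJ]] : exists X, P X /\ forall B, X `<` B -> ~ P B.
  apply: Zorn_bigcup => C CP tC.
  have [|/existsNP[X0 /not_implyP[CX0 X00]]] :=
    pselect (forall X, C X -> X = set0).
    by move=> C0; left; apply/seteqP; split=> // x [X /C0 ->].
  right; set U := \bigcup_(X in C) X.
  have [//|[FX0 IX0]] := CP _ CX0.
  have CF X : C X -> X !=set0 -> F X by move=> /CP[-> [] //|[]].
  have hU : is_ideal U.
    split=> [|x y [X CX Xx] [Y CY Yy]|a x [X CX Xx]].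
    - by exists X0 => //; apply: is_ideal0; exact: hF.
    - have [XY|YX] := tC X Y CX CY.
        exists Y => //; apply: is_idealD => //; last exact: XY.
        by apply/hF/CF => //; exists y.
      exists X => //; apply: is_idealD => //; last exact: YX.
      by apply/hF/CF => //; exists x.
    - by exists X => //; apply: is_idealM => //; apply/hF/CF => //; exists x.
  have [s Us] := nA _ hU.
  have [X CX sX] : exists2 X, C X & [set` s] `<=` X.
    have : [set` s] `<=` U by rewrite Us; exact: ideal_gen_incl.
    elim: s {Us} => [|x s IH] sU; first by exists X0.
    have [|X CX sX] := IH; first by move=> y ys; apply: sU; rewrite /= inE ys orbT.
    have [Y CY Yx] : U x by apply: sU; rewrite /= mem_head.
    have [XY|YX] := tC X Y CX CY.
      by exists Y => // y; rewrite /= inE => /orP[/eqP-> //|/sX/XY].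
    by exists X => // y; rewrite /= inE => /orP[/eqP->|/sX //]; exact: YX.
  have [XX0|X0X] := tC X X0 CX CX0.
    suff -> : U = X0 by [].
    apply/seteqP; split; last by move=> x X0x; exists X0.
    rewrite Us; apply: ideal_gen_min; first exact: hF.
    by apply: subset_trans XX0.
  have FX : F X by apply: CF => //; have [x X0x] := ne _ FX0; exists x; exact: X0X.
  suff -> : U = X by split=> //; exact: subset_trans X0X.
  apply/seteqP; split; last by move=> x X0x; exists X.
  by rewrite Us; apply: ideal_gen_min; first exact: hF.
have [J0|[FJ IJ]] := PJ.
  have /hJ[] : J `<` I.
    by rewrite J0; split=> // I0; have [x Ix] := ne _ FI; exact: (I0 x).
  by right; split.
exists J; split=> // J' FJ' JJ'; apply: contrapT => neq.
have /hJ[] : J `<` J' by split=> // J'J; apply: neq; apply/seteqP.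
by right; split=> //; exact: subset_trans JJ'.
Qed.

Lemma noetherian_sub_maximal I : noetherian A -> is_ideal I -> ~ I 1 ->
  exists2 m, is_maximal_ideal m & I `<=` m.
Proof.
move=> nA hI I1.
have [|m [[hm m1] Im mmax]] := @noetherian_max [set J | is_ideal J /\ ~ J 1] nA _ I (conj hI I1).
  by move=> J [].
by exists m => //; split=> // J hJ J1 mJ; exact: mmax.
Qed.

Lemma maximal_ideal_prime (m : set A) : is_maximal_ideal m -> is_prime_ideal m.
Proof.
move=> [hm m1 mmax]; split=> // x y mxy; apply: contrapT => /not_orP[nx ny].
have m1x : adjoin m x 1.
  apply: contrapT => h; apply: nx.
  rewrite -(mmax _ (is_ideal_adjoin x hm) h (@sub_adjoin _ m x)).
  exact: mem_adjoin.
apply: ny; have [a h] := m1x.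
have -> : y = y * (1 - a * x) + a * (x * y) by ring.
by apply: is_idealD => //; apply: is_idealM.
Qed.

(** An ideal p maximal among those containing I and missing M is prime: for x and y outside p, both
    p + (x) and p + (y) meet M, and the product of the two meeting elements would lie in p if x y
    did. *)
Lemma prime_avoiding_monoid I (M : set A) : noetherian A -> is_ideal I ->
  M 1 -> (forall x y, M x -> M y -> M (x * y)) -> (forall x, M x -> ~ I x) ->
  exists p, [/\ is_prime_ideal p, I `<=` p & forall x, M x -> ~ p x].
Proof.
move=> nA hI M1 MM MI.
have [|p [[hp pM] Ip pmax]] :=
  @noetherian_max [set J | is_ideal J /\ forall x, M x -> ~ J x] nA _ I (conj hI MI).
  by move=> J [].
exists p; split=> //; split=> //; first exact: pM.
move=> x y pxy; apply: contrapT => /not_orP[nx ny].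
have meet z : ~ p z -> exists2 u, M u & adjoin p z u.
  move=> nz; apply: contrapT => h; apply: nz.
  rewrite -(pmax (adjoin p z)); first exact: mem_adjoin.
    split; first exact: is_ideal_adjoin.
    by move=> u Mu pu; apply: h; exists u.
  exact: sub_adjoin.
have [u Mu [a ha]] := meet _ nx; have [v Mv [b hb]] := meet _ ny.
apply: (pM (u * v)); first exact: MM.
have -> : u * v = v * (u - a * x) + a * x * (v - b * y) + a * b * (x * y) by ring.
by apply: is_idealD => //; [apply: is_idealD => //|]; apply: is_idealM.
Qed.

(* The multiplicative set {u f^n | u notin p} misses I because f is regular. *)
Lemma prime_descent I p f : noetherian A -> is_ideal I -> is_prime_ideal p ->
  I `<=` p -> p f -> regular_mod I f ->
  exists p', [/\ is_prime_ideal p', I `<=` p' & p' `<` p].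
Proof.
move=> nA hI [hp p1 pM] Ip pf rf.
have [| | |p' [hp' Ip' p'M]] := @prime_avoiding_monoid I
  [set x | exists u n, ~ p u /\ x = u * f ^+ n] nA hI.
- by exists 1, 0%N; rewrite mulr1.
- move=> x y [u [n [pu ->]]] [v [m [pv ->]]]; exists (u * v), (n + m)%N.
  by split; [case/pM | rewrite exprD; ring].
- move=> x [u [n [pu ->]]] h; apply: pu; apply: Ip.
  elim: n h => [|n IH]; first by rewrite mulr1.
  by rewrite exprSr mulrA => /rf.
exists p'; split=> //; split=> [x p'x|/(_ f pf)].
  by apply: contrapT => px; apply: (p'M x) => //; exists x, 0%N; rewrite mulr1.
by apply: p'M; exists 1, 1%N; rewrite mul1r expr1.
Qed.

(** The chain obtained for I + (f) starts at a prime containing f, and regularity of f produces a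
    prime strictly below it. This yields both that depth is at most dimension and that dimension
    drops by at least the length of a regular sequence. *)
Lemma prime_chain_regular_seq I p s : noetherian A -> is_ideal I -> is_prime_ideal p ->
  adjoins I s `<=` p -> regular_seq_mod I s ->
  exists q, [/\ prime_chain (size s) q, q (size s) = p & I `<=` q 0%N].
Proof.
move=> nA; elim: s I => /= [|f s IH] I hI hp Ip.
  by exists (fun=> p); split.
move=> [rf rs].
have [q [[hq ltq] qE Iq]] := IH _ (is_ideal_adjoin f hI) hp Ip rs.
have [|||p' [hp' Ip' p'q]] := @prime_descent I (q 0%N) f nA hI (hq 0%N isT).
- by move=> x Ix; apply: Iq; exact: sub_adjoin.
- by apply: Iq; exact: mem_adjoin.
- exact: rf.
exists (fun i => if i is i'.+1 then q i' else p'); split=> //; split=> [[|i]|[|i]] //.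
- exact: hq.
- exact: ltq.
Qed.

Lemma prime_chain_cat n m (q r : nat -> set A) : prime_chain n q -> prime_chain m r ->
  q n = r 0%N -> exists t : nat -> set A, prime_chain (n + m) t.
Proof.
move=> [hq ltq] [hr ltr] qr.
exists (fun i => if (i <= n)%N then q i else r (i - n)%N); split=> i hi /=.
  by case: leqP => h; [exact: hq|apply: hr; lia].
case: (ltnP i n) => h; first by rewrite (ltnW h); exact: ltq.
have ltr' : r (i - n)%N `<` r (i.+1 - n)%N by rewrite subSn //; apply: ltr; lia.
case: leqP => h' //.
have iE : i = n by lia.
by move: ltr'; rewrite iE subnn -qr.
Qed.

End Primes.

(** * Zero divisors and exchange of regular sequences *)

Section Depth.
Local Open Scope classical_set_scope.
Local Open Scope ring_scope.
Variable A : comPzRingType.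
Implicit Types (I J p m : set A) (x y a f : A) (s : seq A).

Definition colon I a : set A := [set x | I (x * a)].

Lemma is_ideal_colon I a : is_ideal I -> is_ideal (colon I a).
Proof.
move=> hI; split; rewrite /colon /=.
- by rewrite mul0r; exact: is_ideal0.
- by move=> x y; rewrite mulrDl; exact: is_idealD.
- by move=> b x; rewrite -mulrA; exact: is_idealM.
Qed.

(** (I : a) is maximal among annihilators of nonzero elements of A/I; these are associated primes of
    A/I, and in a noetherian ring they cover the zero divisors. *)
Definition maximal_colon I a :=
  ~ I a /\ forall b, ~ I b -> colon I a `<=` colon I b -> colon I b = colon I a.

(** For y outside (I : a), maximality gives (I : y a) = (I : a); so x y in (I : a) forces x in (I :
    a). *)
Lemma prime_maximal_colon I a :
  is_ideal I -> maximal_colon I a -> is_prime_ideal (colon I a).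
Proof.
move=> hI [Ia amax]; split; first exact: is_ideal_colon.
  by rewrite /colon /= mul1r.
move=> x y hxy; apply: contrapT => /not_orP[nx ny]; apply: nx.
rewrite -(amax (y * a)) //; first by rewrite /colon /= mulrA.
by move=> z; rewrite /colon /= mulrCA; exact: is_idealM.
Qed.

Lemma zero_divisor_maximal_colon I x : noetherian A -> is_ideal I ->
  ~ regular_mod I x -> exists2 a, maximal_colon I a & I (x * a).
Proof.
move=> nA hI /existsNP[a /not_implyP[Iax Ia]].
have [J [b [[Ib ->] abJ Jmax]]] :
    exists J b, [/\ ~ I b /\ J = colon I b, colon I a `<=` J
    & forall c, ~ I c -> J `<=` colon I c -> colon I c = J].
  have [||J [[b Ib JE] abJ Jmax]] :=
    @noetherian_max A [set J | exists2 b, ~ I b & J = colon I b] nA _ (colon I a).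
  - by move=> J [b _ ->]; exact: is_ideal_colon.
  - by exists a.
  by exists J, b; split=> // c Ic; apply: Jmax; exists c.
exists b => //; apply: abJ.
by rewrite /colon /= mulrC.
Qed.

Lemma noetherian_gen_finite (G : set A) : noetherian A ->
  exists2 s : seq A, [set` s] `<=` G & ideal_gen G = ideal_gen [set` s].
Proof.
move=> nA; have [t tE] := nA _ (ideal_genP G).
suff [s sG ts] : exists2 s : seq A, [set` s] `<=` G & [set` t] `<=` ideal_gen [set` s].
  exists s => //; apply/seteqP; split.
    by rewrite tE; apply: ideal_gen_min => //; exact: ideal_genP.
  apply: ideal_gen_min; first exact: ideal_genP.
  by move=> x /sG; exact: ideal_gen_incl.
have : [set` t] `<=` ideal_gen G by rewrite tE; exact: ideal_gen_incl.
elim: t {tE} => [|x t IH] tG; first by exists [::].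
have [|s sG ts] := IH; first by move=> y yt; apply: tG; rewrite /= inE yt orbT.
have [cs [hcs xE]] : ideal_gen G x by apply: tG; rewrite /= mem_head.
exists ([seq c.2 | c <- cs] ++ s).
  by move=> y; rewrite /= mem_cat => /orP[/mapP[c /hcs ? ->]|/sG].
move=> y; rewrite /= inE => /orP[/eqP ->|/ts].
  exists cs; split=> // c ccs; rewrite /= mem_cat; apply/orP; left.
  exact: map_f.
apply: ideal_gen_min; first exact: ideal_genP.
by move=> z zs; apply: ideal_gen_incl; rewrite /= mem_cat orbC zs.
Qed.

(** If each (I : g) had an element outside p, the product of these elements would lie outside p and
    multiply every g, hence a, into I; but (I : a) lies in p. *)
Lemma prime_contains_colon I p (gs : seq A) a :
  is_ideal I -> is_prime_ideal p -> ideal_gen [set` gs] a ->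
  colon I a `<=` p -> exists2 g, g \in gs & colon I g `<=` p.
Proof.
move=> hI [hp p1 pM] ga ap; apply: contrapT => /forall2NP h.
suff [z pz zg] : exists2 z, ~ p z & forall g, g \in gs -> I (z * g).
  apply: pz; apply: ap; have [cs [hcs ->]] := ga.
  rewrite /colon /= big_distrr /= big_seq; apply: is_ideal_sum => // c /hcs /zg Izc.
  by rewrite mulrCA; exact: is_idealM.
have : forall g, g \in gs -> ~ colon I g `<=` p by move=> g; have [] := h g.
elim: gs {h ga} => [|g gs IH] h; first by exists 1.
have [|z pz zg] := IH; first by move=> g' g'gs; apply: h; rewrite inE g'gs orbT.
have /existsNP[y /not_implyP[yg py]] := h g (mem_head _ _).
exists (z * y); first by case/pM.
move=> g'; rewrite inE => /orP[/eqP ->|/zg h'].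
  by rewrite -mulrA; exact: is_idealM.
by rewrite mulrAC; exact: is_idealMr.
Qed.

(* If (I : a) is maximal and a lies in the ideal generated by the gs, then   *)
(* (I : a) contains the intersection of the (I : g), hence one of them.      *)
Lemma finite_zero_divisor_colons I : noetherian A -> is_ideal I ->
  exists gs : seq A, (forall g, g \in gs -> maximal_colon I g) /\
    forall x, ~ regular_mod I x -> exists2 g, g \in gs & I (x * g).
Proof.
move=> nA hI; have [gs gsG gsE] := noetherian_gen_finite (maximal_colon I) nA.
exists gs; split; first exact: gsG.
move=> x /(zero_divisor_maximal_colon nA hI)[a amax xa].
have [|||g ggs ga] := @prime_contains_colon I (colon I a) gs a hI.
- exact: prime_maximal_colon.
- by rewrite -gsE; exact: ideal_gen_incl.
- by [].
exists g => //; have [_ gmax] := gsG _ ggs.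
have Ia : ~ I a by case: amax.
by have : colon I g x by rewrite -(gmax _ Ia ga).
Qed.

Lemma prime_avoidance m (ps : seq (set A)) : is_ideal m ->
  (forall p, p \in ps -> is_prime_ideal p /\ ~ m `<=` p) ->
  exists2 c, m c & forall p, p \in ps -> ~ p c.
Proof.
move=> hm; have [n le_n] := ubnP (size ps).
elim: n ps le_n => // n IH [|p ps] /=; first by exists 0 => //; exact: is_ideal0.
rewrite ltnS => sz hps.
have [hp mp] := hps p (mem_head _ _).
have hps' q : q \in ps -> is_prime_ideal q /\ ~ m `<=` q.
  by move=> qps; apply: hps; rewrite inE qps orbT.
have [[q qps qp]|nsub] := pselect (exists2 q, q \in ps & q `<=` p).
  have [||c mc hc] := IH (p :: rem q ps).
  - rewrite /= size_rem //; apply: leq_ltn_trans sz.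
    by case: (ps) qps.
  - by move=> q'; rewrite inE => /orP[/eqP-> //|/mem_rem /hps'].
  exists c => // q'; rewrite inE => /orP[/eqP->|q'ps].
    by apply: hc; rewrite mem_head.
  have [->|ne] := eqVneq q' q.
    by move/qp; apply: hc; rewrite mem_head.
  by apply: hc; rewrite inE; apply/orP; right; apply: rem_mem.
have [c mc hc] := IH ps sz hps'.
have [pc|npc] := pselect (p c); last first.
  by exists c => // q; rewrite inE => /orP[/eqP->|/hc].
suff [d [md dps pd]] : exists d, [/\ m d, forall q, q \in ps -> q d & ~ p d].
  exists (c + d); first exact: is_idealD.
  move=> q; rewrite inE => /orP[/eqP-> h|qps h].
    by apply: pd; rewrite -(addKr c d) addrC; apply: is_idealB => //; case: hp.
  apply: (hc _ qps); rewrite -(addrK d c).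
  by have [[hq _ _] _] := hps' _ qps; apply: is_idealB => //; exact: dps.
have pM : forall x y, ~ p x -> ~ p y -> ~ p (x * y).
  by case: hp => _ _ pM x y px py /pM[].
have {nsub} : forall q, q \in ps -> ~ q `<=` p by move=> q qps h; apply: nsub; exists q.
have /existsNP[u /not_implyP[mu pu]] := mp.
have : forall q, q \in ps -> is_ideal q by move=> q /hps'[[]].
elim: (ps) => [_ _|q qs IHq hq nq]; first by exists u.
have [||d [md dqs pd]] := IHq.
- by move=> q' h; apply: hq; rewrite inE h orbT.
- by move=> q' h; apply: nq; rewrite inE h orbT.
have /existsNP[v /not_implyP[qv pv]] := nq q (mem_head _ _).
exists (v * d); split; [exact: is_idealM| |exact: pM].
move=> q'; rewrite inE => /orP[/eqP->|q'qs].
  by apply: is_idealMr => //; apply: hq; rewrite mem_head.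
by apply: is_idealM (dqs _ q'qs); apply: hq; rewrite inE q'qs orbT.
Qed.

(** For each ideal of [Is], finitely many maximal colon ideals cover the zero divisors. None
    contains m, since m has a regular element for that ideal, so prime avoidance applies to all of
    them at once. *)
Lemma common_regular_mod m (Is : seq (set A)) : noetherian A -> is_ideal m ->
  (forall I, I \in Is -> is_ideal I /\ exists2 u, m u & regular_mod I u) ->
  exists2 c, m c & forall I, I \in Is -> regular_mod I c.
Proof.
move=> nA hm hIs.
suff [ps hps zps] : exists2 ps : seq (set A),
    (forall p, p \in ps -> is_prime_ideal p /\ ~ m `<=` p) &
    forall I x, I \in Is -> ~ regular_mod I x -> exists2 p, p \in ps & p x.
  have [c mc hc] := prime_avoidance hm hps; exists c => // I IIs.
  by apply: contrapT => /(zps _ _ IIs)[p /hc].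
elim: Is hIs => [|I Is IH] hIs; first by exists [::].
have [|ps hps zps] := IH; first by move=> J h; apply: hIs; rewrite inE h orbT.
have [hI [u mu ru]] := hIs I (mem_head _ _).
have [gs [gmax gz]] := finite_zero_divisor_colons nA hI.
exists ([seq colon I g | g <- gs] ++ ps).
  move=> p; rewrite mem_cat => /orP[/mapP[g /gmax hg ->]|/hps //].
  split; first exact: prime_maximal_colon.
  case: hg => Ig _ /(_ u mu); rewrite /colon /= mulrC => /ru; exact: Ig.
move=> J x; rewrite inE => /orP[/eqP->|JIs].
  move=> /gz[g ggs Ixg]; exists (colon I g) => //.
  by rewrite mem_cat map_f.
by move=> /(zps _ _ JIs)[p pps px]; exists p => //; rewrite mem_cat pps orbT.
Qed.

(* If all of m were zero divisors modulo I + (f), some c outside I + (f) would *)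
(* satisfy m c <= I + (f); writing a c = b f, b witnesses that m consists of   *)
(* zero divisors modulo I + (a).                                               *)
Lemma regular_mod_transfer m I a f u : noetherian A -> is_ideal m -> is_ideal I ->
  m a -> m f -> regular_mod I a -> regular_mod I f ->
  m u -> regular_mod (adjoin I a) u ->
  exists2 v, m v & regular_mod (adjoin I f) v.
Proof.
move=> nA hm hI ma mf ra rf mu ru; apply: contrapT => /forall2NP nreg.
have hIf := is_ideal_adjoin f hI.
have [gs [gmax gz]] := finite_zero_divisor_colons nA hIf.
have [c cf mc] : exists2 c, ~ adjoin I f c & forall x, m x -> adjoin I f (x * c).
  apply: contrapT => /forall2NP h.
  have [|v mv hv] := @prime_avoidance m [seq colon (adjoin I f) g | g <- gs] hm.
    move=> p /mapP[g /gmax hg ->]; split; first exact: prime_maximal_colon.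
    by case: (h g) => [[]|//]; case: hg.
  have [//|[]] := nreg v; apply: contrapT => /gz[g ggs h'].
  by apply: (hv (colon (adjoin I f) g)) => //; exact: map_f.
have [b hb] := mc a ma.
have /ru[d hd] : adjoin I a (b * u).
  have [e he] := mc u mu; exists e; apply: rf.
  have -> : (b * u - e * a) * f = a * (u * c - e * f) - u * (a * c - b * f) by ring.
  by apply: is_idealB => //; exact: is_idealM.
apply: cf; exists d; apply: ra.
have -> : (c - d * f) * a = (a * c - b * f) + f * (b - d * a) by ring.
by apply: is_idealD => //; exact: is_idealM.
Qed.

(** Induction on the length of s = a, u, ... . Choose c in m regular modulo I, I + (a) and I + (f);
    the last is possible by [regular_mod_transfer]. Modulo I + (a), exchange u for c, giving a, c,
    t; swap to c, a, t. Modulo I + (c), exchange a for f, giving c, f, w; swap to f, c, w. *)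
Lemma regular_seq_exchange m I f s : noetherian A -> is_ideal m -> is_ideal I ->
  regular_seq_mod I s -> [set` s] `<=` m -> m f -> regular_mod I f -> (0 < size s)%N ->
  exists t, [/\ size t = (size s).-1, [set` t] `<=` m & regular_seq_mod I (f :: t)].
Proof.
move=> nA hm; have [n le_n] := ubnP (size s).
elim: n I f s le_n => // n IH I f [//|a [|u s]] /=; rewrite ltnS => sz hI.
  by move=> _ _ mf rf _; exists [::].
move=> [ra [ru rs]] sm mf rf _.
have ma : m a by apply: sm; rewrite /= mem_head.
have mu : m u by apply: sm; rewrite /= !inE eqxx orbT.
have [v mv rv] := regular_mod_transfer nA hm hI ma mf ra rf mu ru.
have [|c mc hc] := @common_regular_mod m [:: I; adjoin I a; adjoin I f] nA hm.
  move=> J; rewrite !inE => /or3P[] /eqP ->; split=> //; try exact: is_ideal_adjoin.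
  - by exists a.
  - by exists u.
  - by exists v.
have rc : regular_mod I c by apply: hc; rewrite !inE eqxx.
have rac : regular_mod (adjoin I a) c by apply: hc; rewrite !inE eqxx orbT.
have rfc : regular_mod (adjoin I f) c by apply: hc; rewrite !inE eqxx !orbT.
have hIa := is_ideal_adjoin a hI; have hIc := is_ideal_adjoin c hI.
have [||t [/= szt tm [_ rt]]] := IH (adjoin I a) c (u :: s) sz hIa _ _ mc rac isT.
- by split.
- by move=> x xs; apply: sm; rewrite /= inE xs orbT.
have [//|_ rat] := @regular_seq_mod_swap _ I a c t hI rc.
have [|||w [/= szw wm rw]] := IH (adjoin I c) f (a :: t) _ hIc rat _ mf _ isT.
- by rewrite /= szt.
- by move=> x; rewrite /= inE => /orP[/eqP->//|/tm].
- exact: regular_mod_swap rfc.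
exists (c :: w); split=> /=.
- by rewrite szw szt.
- by move=> x; rewrite /= inE => /orP[/eqP->//|/wm].
exact: (@regular_seq_mod_swap _ I c f w).
Qed.

(** Each element of [fs] is exchanged in turn, at the cost of one element of s. This bounds the
    depth of a quotient from below. *)
Lemma regular_seq_extend m I fs s : noetherian A -> is_ideal m -> is_ideal I ->
  regular_seq_mod I s -> [set` s] `<=` m -> regular_seq_mod I fs ->
  [set` fs] `<=` m -> (size fs <= size s)%N ->
  exists t, [/\ size t = (size s - size fs)%N, [set` t] `<=` m &
    regular_seq_mod I (fs ++ t)].
Proof.
move=> nA hm; elim: fs I s => [|f fs IH] I s hI rs sm rf fm /= sz.
  by exists s; rewrite subn0.
case: rf => rf rfs.
have mf : m f by apply: fm; rewrite /= mem_head.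
have [t [szt tm [_ rt]]] := regular_seq_exchange nA hm hI rs sm mf rf (leq_ltn_trans (leq0n _) sz).
have [||w [szw wm rw]] := IH _ t (is_ideal_adjoin f hI) rt tm rfs.
- by move=> x xfs; apply: fm; rewrite /= inE xfs orbT.
- by rewrite szt; lia.
exists w; split=> //.
by rewrite szw szt; lia.
Qed.

End Depth.

(** * Quotients by regular sequences *)

Section Surjection.
Local Open Scope classical_set_scope.
Local Open Scope ring_scope.
Variables (A B : comPzRingType) (psi : {rmorphism A -> B}).
Implicit Types (J : set B) (x : A) (s : seq A).

Lemma is_ideal_preimage J : is_ideal J -> is_ideal (psi @^-1` J).
Proof.
move=> hJ; split; rewrite /preimage /=.
- by rewrite rmorph0; exact: is_ideal0.
- by move=> x y; rewrite rmorphD; exact: is_idealD.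
- by move=> a x; rewrite rmorphM; exact: is_idealM.
Qed.

Lemma is_prime_ideal_preimage J : is_prime_ideal J -> is_prime_ideal (psi @^-1` J).
Proof.
move=> [hJ J1 JM]; split; first exact: is_ideal_preimage.
  by rewrite /preimage /= rmorph1.
by move=> x y; rewrite /preimage /= rmorphM; exact: JM.
Qed.

Hypothesis psi_surj : forall y, exists x, psi x = y.

Lemma preimage_surj_inj J J' : psi @^-1` J `<=` psi @^-1` J' -> J `<=` J'.
Proof. by move=> h y; have [x <-] := psi_surj y; exact: h. Qed.

Lemma noetherian_surj : noetherian A -> noetherian B.
Proof.
move=> nA J hJ; have [s sE] := nA _ (is_ideal_preimage hJ).
exists (map psi s); apply/seteqP; split.
  apply: preimage_surj_inj; rewrite sE; apply: ideal_gen_min.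
    by apply: is_ideal_preimage; exact: ideal_genP.
  by move=> x xs; apply: ideal_gen_incl; exact: map_f.
apply: ideal_gen_min => // y /mapP[x xs ->].
have : ideal_gen [set` s] x by exact: ideal_gen_incl.
by rewrite -sE.
Qed.

Lemma preimage_adjoin J x : psi @^-1` (adjoin J (psi x)) = adjoin (psi @^-1` J) x.
Proof.
apply/seteqP; split=> z [a h].
  by have [b bE] := psi_surj a; exists b; rewrite /preimage /= rmorphB rmorphM bE.
by exists (psi a); move: h; rewrite /preimage /= rmorphB rmorphM.
Qed.

Lemma preimage_adjoins J s :
  psi @^-1` (adjoins J (map psi s)) = adjoins (psi @^-1` J) s.
Proof. by elim: s J => //= x s IH J; rewrite IH preimage_adjoin. Qed.

Lemma regular_mod_preimage J x :
  regular_mod J (psi x) <-> regular_mod (psi @^-1` J) x.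
Proof.
split=> h a; first by rewrite /preimage /= rmorphM; exact: h.
by have [b <-] := psi_surj a; rewrite -rmorphM; exact: h.
Qed.

Lemma regular_seq_mod_preimage J s :
  regular_seq_mod J (map psi s) <-> regular_seq_mod (psi @^-1` J) s.
Proof.
elim: s J => //= x s IH J.
by rewrite IH preimage_adjoin; have := regular_mod_preimage J x; tauto.
Qed.

(** Let n be the dimension and depth of A and e the length of [fs]. Depth and dimension of B are
    both n - e, each inequality being obtained by carrying regular sequences or prime chains between
    A and B. *)
Lemma cohen_macaulay_local_surj fs : cohen_macaulay_local A ->
  regular_seq_mod [set 0] fs -> psi @^-1` [set 0] = adjoins [set 0] fs ->
  (1 : B) <> 0 -> cohen_macaulay_local B.
Proof.
move=> [nA [m [mmax muniq [n [[_ dimA] [[s [/regular_sequenceP[rs _] sm sz]] depthA]]]]]].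
move=> rfs kerE nzB; have nB := noetherian_surj nA.
set K := psi @^-1` [set 0] in kerE.
have z0A := is_ideal_zero A; have z0B := is_ideal_zero B.
have hK : is_ideal K by exact: is_ideal_preimage.
have sub_m (J : set A) : is_ideal J -> ~ J 1 -> J `<=` m.
  by move=> hJ /(noetherian_sub_maximal nA hJ)[m' /muniq ->].
have K1 : ~ K 1 by rewrite /K /preimage /= rmorph1.
have Km := sub_m _ hK K1.
have [hm m1 mtop] := mmax.
pose m' := psi @` m.
have m'E : psi @^-1` m' = m.
  apply/seteqP; split; last by move=> x mx; exists x.
  move=> x [y my xy]; rewrite -(subrK y x); apply: is_idealD => //.
  by apply: Km; rewrite /K /preimage /= rmorphB xy subrr.
have hm' : is_ideal m'.
  split=> [|_ _ [x mx <-] [y my <-]|a _ [x mx <-]].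
  - by exists 0; rewrite ?rmorph0 //; exact: is_ideal0.
  - by exists (x + y); rewrite ?rmorphD //; exact: is_idealD.
  - have [b <-] := psi_surj a.
    by exists (b * x); rewrite ?rmorphM //; exact: is_idealM.
have m'1 : ~ m' 1 by rewrite -(rmorph1 psi) => h; apply: m1; rewrite -m'E.
have sub_m' (J : set B) : is_ideal J -> ~ J 1 -> J `<=` m'.
  move=> hJ J1; apply: preimage_surj_inj; rewrite m'E.
  by apply: sub_m; [exact: is_ideal_preimage|rewrite /preimage /= rmorph1].
have m'max : is_maximal_ideal m'.
  split=> // J hJ J1 m'J; apply/seteqP; split=> //; exact: sub_m'.
have fsK : [set` fs] `<=` K by rewrite kerE; exact: mem_adjoins.
have fsm : [set` fs] `<=` m := subset_trans fsK Km.
have reg_m t : regular_seq_mod [set 0] t -> [set` t] `<=` m -> regular_sequence t.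
  move=> rt tm; apply/regular_sequenceP; split=> // /(adjoins_min hm _ tm).
  by move=> h; apply: m1; apply: h => _ ->; exact: is_ideal0.
have e_le_n : (size fs <= n)%N by apply: depthA => //; exact: reg_m.
(* [fs] extends inside m to a regular sequence of length n; the image of the added part [t] is
   regular in B and has length n - e. *)
have [|t [szt tm]] := regular_seq_extend nA hm z0A rs sm rfs fsm; first by rewrite sz.
rewrite sz in szt => /regular_seq_mod_cat[_].
rewrite -kerE => /regular_seq_mod_preimage rt.
have tm' : [set` map psi t] `<=` m' by move=> _ /mapP[x /tm mx ->]; exists x.
have sub_t : adjoins [set 0] (map psi t) `<=` m'.
  by apply: adjoins_min => // _ ->; exact: is_ideal0.
split=> //; exists m'; split=> //.
  move=> m'' [hm'' m''1 m''top]; apply/esym/m''top => //; exact: sub_m'.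
exists (n - size fs)%N; split; split.
- have [q [hq _ _]] := prime_chain_regular_seq nB z0B (maximal_ideal_prime m'max) sub_t rt.
  by exists q; rewrite -szt -(size_map psi).
(* A prime chain of B pulls back to one of A whose first prime contains [fs]; e further primes fit
   below it, so its length plus e is at most n. *)
- move=> k q [hq ltq].
  have hq0 := is_prime_ideal_preimage (hq 0%N isT).
  have Kq0 : adjoins [set 0] fs `<=` psi @^-1` q 0%N.
    rewrite -kerE => x; rewrite /K /preimage /= => ->.
    by apply: is_ideal0; case: (hq 0%N isT).
  have [r [hr rE _]] := prime_chain_regular_seq nA z0A hq0 Kq0 rfs.
  have [|w /dimA] := @prime_chain_cat A (size fs) k r (fun i => psi @^-1` q i) hr _ rE.
    split=> i hi; first by apply: is_prime_ideal_preimage; exact: hq.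
    have [sub nsub] := ltq i hi; split; first by move=> x; exact: sub.
    by move=> h; apply: nsub; exact: preimage_surj_inj.
  by move=> /leq_sub2r-/(_ (size fs)); rewrite addKn.
- exists (map psi t); split=> //; last by rewrite size_map.
  by apply/regular_sequenceP; split=> // /sub_t.
(* A regular sequence of B lifts to elements of m; placed after [fs] it is regular in A, so its
   length plus e is at most n. *)
- move=> s' /regular_sequenceP[rs' _] s'm'.
  have [u uE um] : exists2 u : seq A, s' = map psi u & [set` u] `<=` m.
    elim: s' s'm' {rs'} => [|y s' IH] s'm'; first by exists [::].
    have [|u -> um] := IH; first by move=> z zs; apply: s'm'; rewrite /= inE zs orbT.
    have [|x mx <-] := s'm' y; first by rewrite /= mem_head.
    by exists (x :: u) => // z; rewrite /= inE => /orP[/eqP-> //|/um].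
  have /depthA : regular_sequence (fs ++ u).
    apply: reg_m; last by move=> x; rewrite /= mem_cat => /orP[/fsm|/um].
    apply/regular_seq_mod_cat; split=> //; rewrite -kerE.
    by apply/regular_seq_mod_preimage; rewrite -uE.
  rewrite size_cat uE size_map => h; rewrite leq_subRL //; apply: h.
  by move=> x; rewrite /= mem_cat => /orP[/fsm|/um].
Qed.

End Surjection.

(** * Localization and its compatibility with quotients *)

Section LocalizationIdeals.
Local Open Scope classical_set_scope.
Local Open Scope ring_scope.
Local Open Scope quotient_scope.
Variables (A : comPzRingType) (p : primeIdeal A).
Implicit Types (I : set A) (a x : A) (s : denom p) (f g : Defs.frac p).

Lemma loc_piD f g : \pi_(loc p) f + \pi_(loc p) g = \pi_(loc p) (frac_add f g).
Proof. exact/esym/loc_pi_add. Qed.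
Lemma loc_piM f g : \pi_(loc p) f * \pi_(loc p) g = \pi_(loc p) (frac_mul f g).
Proof. exact/esym/loc_pi_mul. Qed.
Lemma loc_piN f : - \pi_(loc p) f = \pi_(loc p) (frac_opp f).
Proof. exact/esym/loc_pi_opp. Qed.
Lemma loc_pi0 : 0 = \pi_(loc p) (0, denom1 p).
Proof. by rewrite [LHS]/(loc_zero p); unlock loc_zero. Qed.
Lemma loc_pi1 : 1 = \pi_(loc p) (1, denom1 p).
Proof. by rewrite [LHS]/(loc_one p); unlock loc_one. Qed.

Definition loc_inj a : loc p := \pi_(loc p) ((a, denom1 p) : Defs.frac p).

(** The extension of I to the localization, tested on the chosen representative; [loc_idealE] shows
    that any representative of the fraction gives the same answer. *)
Definition loc_ideal I : set (loc p) := [set y | exists u : denom p, I (sval u * (repr y).1)].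

Lemma loc_idealE I f : is_ideal I ->
  loc_ideal I (\pi_(loc p) f) <-> exists u : denom p, I (sval u * f.1).
Proof.
move=> hI; rewrite /loc_ideal /=; have [v] := loc_repr f; set f' := repr _ => vE.
have {}vE : sval v * (f'.1 * sval f.2) = sval v * (f.1 * sval f'.2).
  by apply/eqP; rewrite -subr_eq0 -mulrBr vE.
split=> -[u Iu].
  exists (denomM (denomM u v) f'.2) => /=.
  have -> : sval u * sval v * sval f'.2 * f.1 =
            sval v * sval f.2 * (sval u * f'.1) + sval u *
            (sval v * (f.1 * sval f'.2) - sval v * (f'.1 * sval f.2)) by ring.
  by rewrite vE subrr mulr0 addr0; exact: is_idealM.
exists (denomM (denomM u v) f.2) => /=.
have -> : sval u * sval v * sval f.2 * f'.1 =
          sval v * sval f'.2 * (sval u * f.1) + sval u *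
          (sval v * (f'.1 * sval f.2) - sval v * (f.1 * sval f'.2)) by ring.
by rewrite vE subrr mulr0 addr0; exact: is_idealM.
Qed.

Lemma loc_pi_eq0 f : \pi_(loc p) f = 0 <-> exists u : denom p, sval u * f.1 = 0.
Proof.
rewrite loc_pi0; split=> [/eqP/loc_eqP[u]|[u hu]].
  by rewrite /= mulr1 mul0r subr0; exists u.
by apply/eqP/loc_eqP; exists u; rewrite /= mulr1 mul0r subr0.
Qed.

Lemma loc_ideal_zero : loc_ideal [set 0] = [set 0].
Proof.
apply/seteqP; split=> y; rewrite -[y]reprK => h.
  by apply/loc_pi_eq0/(loc_idealE _ (is_ideal_zero A)).
by apply/(loc_idealE _ (is_ideal_zero A)); apply/loc_pi_eq0.
Qed.

Lemma loc_ideal_adjoin I x : is_ideal I ->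
  loc_ideal (adjoin I x) = adjoin (loc_ideal I) (loc_inj x).
Proof.
move=> hI; have hIx := is_ideal_adjoin x hI.
apply/seteqP; split=> y; rewrite -[y]reprK; set f := repr y.
  move=> /(loc_idealE _ hIx)[u [a h]].
  exists (\pi_(loc p) ((a, denomM u f.2) : Defs.frac p)).
  rewrite loc_piM loc_piN loc_piD; apply/loc_idealE => //; exists (denom1 p) => /=.
  have -> : 1 * (f.1 * (sval u * sval f.2 * 1) + - (a * x) * sval f.2) =
            sval f.2 * (sval u * f.1 - a * x) by ring.
  exact: is_idealM.
move=> [a]; rewrite -[a]reprK; set g := repr a.
rewrite loc_piM loc_piN loc_piD => /loc_idealE-/(_ hI)[u /= h].
apply/loc_idealE => //; exists (denomM u g.2); exists (sval u * sval f.2 * g.1) => /=.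
by have <- : sval u * (f.1 * (sval g.2 * 1) + - (g.1 * x) * sval f.2) =
  sval u * sval g.2 * f.1 - sval u * sval f.2 * g.1 * x by ring.
Qed.

Lemma regular_mod_loc I x : is_ideal I ->
  regular_mod I x -> regular_mod (loc_ideal I) (loc_inj x).
Proof.
move=> hI rx a; rewrite -[a]reprK; set f := repr a; rewrite loc_piM.
move=> /loc_idealE-/(_ hI)[u /= h]; apply/loc_idealE => //; exists u.
by apply: rx; rewrite -mulrA.
Qed.

Lemma loc_ideal_adjoins I (s : seq A) : is_ideal I ->
  loc_ideal (adjoins I s) = adjoins (loc_ideal I) (map loc_inj s).
Proof.
elim: s I => //= x s IH I hI; rewrite IH ?loc_ideal_adjoin //.
exact: is_ideal_adjoin.
Qed.

Lemma regular_seq_mod_loc I (s : seq A) : is_ideal I ->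
  regular_seq_mod I s -> regular_seq_mod (loc_ideal I) (map loc_inj s).
Proof.
elim: s I => //= x s IH I hI [rx rs]; split; first exact: regular_mod_loc.
by rewrite -loc_ideal_adjoin //; apply: IH => //; exact: is_ideal_adjoin.
Qed.

Lemma loc_nontrivial : (1 : loc p) <> 0.
Proof.
rewrite loc_pi1 => /loc_pi_eq0[u]; rewrite /= mulr1 => u0.
by case: (Defs.primeP p) => hp _ _; apply: (@Defs.denomP _ _ u); rewrite u0; exact: is_ideal0.
Qed.

End LocalizationIdeals.

Section LocalizationMap.
Local Open Scope classical_set_scope.
Local Open Scope ring_scope.
Local Open Scope quotient_scope.
Variables (A B : comPzRingType) (psi : {rmorphism A -> B}) (p : primeIdeal B).

Definition comap_prime : primeIdeal A :=
  PrimeIdeal (is_prime_ideal_preimage psi (Defs.primeP p)).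

Lemma map_denom_subproof (s : denom comap_prime) : `[< ~ p (psi (sval s)) >].
Proof. apply/asboolP; exact: (@Defs.denomP _ _ s). Qed.

Definition map_denom (s : denom comap_prime) : denom p :=
  exist (fun t : B => `[< ~ p t >]) _ (map_denom_subproof s).

Definition map_frac (f : Defs.frac comap_prime) : Defs.frac p := (psi f.1, map_denom f.2).

Definition map_loc (y : loc comap_prime) : loc p := \pi_(loc p) (map_frac (repr y)).

Lemma map_loc_pi (f : Defs.frac comap_prime) : map_loc (\pi f) = \pi_(loc p) (map_frac f).
Proof.
apply/eqP/loc_eqP; have [u hu] := loc_repr f; exists (map_denom u).
by rewrite /= -!rmorphM -rmorphB -rmorphM hu rmorph0.
Qed.

Lemma map_loc_is_additive : zmod_morphism map_loc.
Proof.
move=> x y; rewrite -[x]reprK -[y]reprK loc_piN loc_piD !map_loc_pi loc_piN loc_piD.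
by apply: loc_pi_ext; rewrite /= rmorphD !rmorphM rmorphN.
Qed.

Lemma map_loc_is_multiplicative : monoid_morphism map_loc.
Proof.
split=> [|x y]; first by rewrite !loc_pi1 map_loc_pi; apply: loc_pi_ext; rewrite /= !rmorph1.
rewrite -[x]reprK -[y]reprK loc_piM !map_loc_pi loc_piM.
by apply: loc_pi_ext; rewrite /= !rmorphM.
Qed.

HB.instance Definition _ :=
  GRing.isZmodMorphism.Build (loc comap_prime) (loc p) map_loc map_loc_is_additive.
HB.instance Definition _ :=
  GRing.isMonoidMorphism.Build (loc comap_prime) (loc p) map_loc map_loc_is_multiplicative.

Hypothesis psi_surj : forall y, exists x, psi x = y.

Lemma denom_lift (t : denom p) : exists s, sval (map_denom s) = sval t.
Proof.
have [s sE] := psi_surj (sval t).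
have hs : `[< ~ comap_prime s >].
  by apply/asboolP; rewrite /= /preimage /= sE; exact: Defs.denomP.
by exists (exist (fun x : A => `[< ~ comap_prime x >]) s hs).
Qed.

Lemma map_loc_surj y : exists x, map_loc x = y.
Proof.
rewrite -[y]reprK; set f := repr y.
have [a aE] := psi_surj f.1; have [s sE] := denom_lift f.2.
exists (\pi_(loc comap_prime) ((a, s) : Defs.frac comap_prime)); rewrite map_loc_pi.
by apply: loc_pi_ext; rewrite /= aE -sE.
Qed.

(** A fraction maps to 0 when some denominator of B kills the image of its numerator; by
    surjectivity that denominator comes from A. *)
Lemma map_loc_ker : map_loc @^-1` [set 0] = loc_ideal (p := comap_prime) (psi @^-1` [set 0]).
Proof.
have hK := is_ideal_preimage psi (is_ideal_zero B).
apply/seteqP; split=> y; rewrite -[y]reprK; set f := repr y.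
  rewrite /preimage /= map_loc_pi => /loc_pi_eq0[u h].
  have [v vE] := denom_lift u; apply/loc_idealE => //; exists v.
  by rewrite /preimage /= rmorphM -[psi (sval v)]/(sval (map_denom v)) vE.
move=> /loc_idealE-/(_ hK)[u]; rewrite /preimage /= map_loc_pi => h.
by apply/loc_pi_eq0; exists (map_denom u); rewrite /= -rmorphM.
Qed.

End LocalizationMap.

Section RingQuotient.
Local Open Scope classical_set_scope.
Local Open Scope ring_scope.

(** For a prime p of B, localizing A at the preimage of p gives a surjection onto the localization
    of B, whose kernel is generated by the images of [fs], still a regular sequence; the local case
    applies. *)
Theorem cohen_macaulay_ring_surj (A B : comPzRingType) (psi : {rmorphism A -> B})
    (fs : seq A) : (forall y, exists x, psi x = y) ->
  regular_seq_mod [set 0] fs -> psi @^-1` [set 0] = adjoins [set 0] fs ->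
  cohen_macaulay_ring A -> cohen_macaulay_ring B.
Proof.
move=> psi_surj rfs kerE [nA cmA]; split; first exact: noetherian_surj nA.
move=> p; have z0 := is_ideal_zero A.
apply: (@cohen_macaulay_local_surj _ _ (map_loc (psi := psi) (p := p)) _
  (map (@loc_inj _ (comap_prime psi p)) fs)).
- exact: map_loc_surj.
- exact: cmA.
- by rewrite -loc_ideal_zero; exact: regular_seq_mod_loc.
- by rewrite map_loc_ker // kerE loc_ideal_adjoins // loc_ideal_zero.
- exact: loc_nontrivial.
Qed.

End RingQuotient.

(** * Monomial ideals *)

Section MonomialIdeals.
Local Open Scope classical_set_scope.
Local Open Scope ring_scope.
Variables (k : fieldType) (I : finType).
Local Notation R := {mpoly k[#|I|]}.
Implicit Types (C T : {set I}) (F : set {set I}) (a b : R) (i : I) (K : set R).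

Definition var i : R := 'X_(enum_rank i).
Definition set_monomial C : R := \prod_(i in C) var i.
Definition monomial_ideal F : set R := ideal_gen [set a | exists2 C, F C & a = set_monomial C].

Lemma is_ideal_monomial F : is_ideal (monomial_ideal F).
Proof. exact: ideal_genP. Qed.

Lemma mem_monomial_ideal F C : F C -> monomial_ideal F (set_monomial C).
Proof. by move=> FC; apply: ideal_gen_incl; exists C. Qed.

Definition set_mnm C : 'X_{1.. #|I|} := (\sum_(i in C) U_(enum_rank i))%MM.

Lemma set_monomialE C : set_monomial C = 'X_[set_mnm C].
Proof. exact: mprodXE. Qed.

(** The support condition defines an ideal containing the generators; conversely each term of such a
    polynomial is a multiple of a generator. *)
Lemma monomial_idealP F a : monomial_ideal F a <->
  forall m, m \in msupp a -> exists2 C, F C & (set_mnm C <= m)%MM.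
Proof.
split; last first.
  move=> h; rewrite (mpolyE a) big_seq; apply: is_ideal_sum => [|m /h[C FC Cm]].
    exact: is_ideal_monomial.
  rewrite -mul_mpolyC -(submK Cm) mpolyXD mulrA -set_monomialE.
  by apply: is_idealM; [exact: is_ideal_monomial|exact: mem_monomial_ideal].
move: a; apply: ideal_gen_min; last first.
  move=> _ [C FC ->] m; rewrite set_monomialE => /mem_msuppXP <-.
  by exists C => //; exact: lepm_refl.
split=> [m|a b ha hb m|a b hb m]; first by rewrite msupp0.
  by move=> /msuppD_le; rewrite mem_cat => /orP[/ha|/hb].
move=> /msuppM_le /allpairsP[[m1 m2] /= [_ /hb[C FC Cm] ->]]; exists C => //.
by apply: lepm_trans Cm _; exact: lem_addl.
Qed.

(** Induction on the exponent of x_i in a monomial m of a. If m does not occur in a (x_i - 1), the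
    coefficients of m in a and in a x_i agree, so m / x_i occurs in a with a smaller exponent; a
    generator dividing it divides m. *)
Lemma regular_mod_monomial F i : regular_mod (monomial_ideal F) (var i - 1).
Proof.
move=> a /monomial_idealP h; apply/monomial_idealP => m.
have [d] := ubnP (m (enum_rank i)).
elim: d m => // d IH m; rewrite ltnS => md ma.
have [/h//|] := boolP (m \in msupp (a * (var i - 1))).
rewrite -mcoeff_eq0 mulrBr mulr1 mcoeffB subr_eq0 => /eqP mE.
have : m \in msupp (a * var i) by rewrite mcoeff_msupp mE -mcoeff_msupp.
rewrite (perm_mem (msuppMX _ _)) => /mapP[m' m'a mm'].
have [|C FC Cm'] := IH m' _ m'a.
  by move: md; rewrite mm' mnmDE mnm1E eqxx; lia.
by exists C => //; apply: lepm_trans Cm' _; rewrite mm'; exact: lem_addl.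
Qed.

Definition subst (I' : finType) (g : I -> {mpoly k[#|I'|]}) : R -> {mpoly k[#|I'|]} :=
  comp_mpoly [tuple g (enum_val j) | j < #|I|].

HB.instance Definition _ I' g := GRing.RMorphism.on (@subst I' g).

Lemma subst_var (I' : finType) (g : I -> {mpoly k[#|I'|]}) i : subst g (var i) = g i.
Proof. by rewrite /subst comp_mpolyXU -tnth_nth tnth_mktuple enum_rankK. Qed.

Lemma subst_const (I' : finType) (g : I -> {mpoly k[#|I'|]}) c : subst g c%:MP = c%:MP.
Proof. exact: comp_mpolyC. Qed.

Lemma congr_mod_prod K (J : Type) (r : seq J) (P : pred J) (f g : J -> R) : is_ideal K ->
  (forall j, P j -> K (f j - g j)) -> K (\prod_(j <- r | P j) f j - \prod_(j <- r | P j) g j).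
Proof.
move=> hK h; apply: (big_ind2 (fun x y => K (x - y))) => //.
  by rewrite subrr; exact: is_ideal0.
move=> x x' y y' Kx Ky.
have -> : x * y - x' * y' = y * (x - x') + x' * (y - y') by ring.
by apply: is_idealD => //; exact: is_idealM.
Qed.

Lemma endo_congr_mod K (theta : {rmorphism R -> R}) a : is_ideal K ->
  (forall c, theta c%:MP = c%:MP) -> (forall i, K (var i - theta (var i))) ->
  K (a - theta a).
Proof.
move=> hK tc tv; rewrite {2}(mpolyE a) rmorph_sum {1}(mpolyE a) -sumrB.
apply: is_ideal_sum => // m _; rewrite -mul_mpolyC rmorphM tc -mulrBr.
apply: is_idealM => //; rewrite mpolyXE_id rmorph_prod; apply: congr_mod_prod => // j _.
rewrite rmorphXn /= subrXX; apply: is_idealMr => //.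
by rewrite -(enum_valK j); exact: tv.
Qed.

Definition set_one T : R -> R := subst (fun i => if i \in T then 1 else var i).

HB.instance Definition _ T := GRing.RMorphism.on (set_one T).

Lemma set_one_var T i : set_one T (var i) = if i \in T then 1 else var i.
Proof. exact: subst_var. Qed.

Lemma set_one_monomial T C : set_one T (set_monomial C) = set_monomial (C :\: T).
Proof.
rewrite /set_monomial rmorph_prod /= (eq_bigr (fun i => if i \notin T then var i else 1)).
  rewrite -big_mkcondr; apply: eq_bigl => i; by rewrite !inE andbC.
by move=> i _; rewrite set_one_var; case: ifP.
Qed.

Lemma set_one_congr T K a : is_ideal K -> (forall i, i \in T -> K (var i - 1)) ->
  K (a - set_one T a).
Proof.
move=> hK KT; apply: endo_congr_mod => // [c|i].
  exact: subst_const.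
by rewrite [X in var i - X]set_one_var; case: ifP => [/KT//|_]; rewrite subrr; exact: is_ideal0.
Qed.

Lemma set_monomial_congr T K C : is_ideal K -> (forall i, i \in T -> K (var i - 1)) ->
  K (set_monomial C) <-> K (set_monomial (C :\: T)).
Proof.
move=> hK /(set_one_congr (set_monomial C) hK); rewrite set_one_monomial => h.
split=> Ka; [rewrite -(subKr (set_monomial C) (set_monomial (C :\: T)))|
  rewrite -(subrK (set_monomial (C :\: T)) (set_monomial C))].
  exact: is_idealB.
exact: is_idealD.
Qed.

(** Modulo the x_i - 1 every polynomial equals its image under [set_one]. Membership in the
    enlarged, non-monomial ideal thus becomes membership in a monomial ideal, so that
    [regular_mod_monomial] can be iterated. *)
Lemma adjoins_set_one F (s : seq I) a :
  adjoins (monomial_ideal F) [seq var i - 1 | i <- s] a <->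
  monomial_ideal [set C :\: [set i in s] | C in F] (set_one [set i in s] a).
Proof.
set J := adjoins _ _; set T := finset _.
have hJ : is_ideal J by apply: is_ideal_adjoins; exact: is_ideal_monomial.
have JT i : i \in T -> J (var i - 1).
  rewrite inE => si; apply: mem_adjoins; first exact: is_ideal_monomial.
  exact: (map_f (fun i => var i - 1)).
split.
  move: a; apply: (@adjoins_min _ _ (set_one T @^-1` monomial_ideal _)).
  - by apply: (is_ideal_preimage (set_one T)); exact: is_ideal_monomial.
  - apply: ideal_gen_min.
      by apply: (is_ideal_preimage (set_one T)); exact: is_ideal_monomial.
    move=> _ [C FC ->]; rewrite /preimage /= set_one_monomial.
    by apply: mem_monomial_ideal; exists C.
  - move=> _ /mapP[i si ->]; rewrite /preimage /mkset rmorphB rmorph1 [X in X - 1]set_one_var.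
    by rewrite inE si subrr; apply: is_ideal0; exact: is_ideal_monomial.
move=> h; rewrite -(subrK (set_one T a) a); apply: is_idealD => //.
  exact: (set_one_congr _ hJ JT).
move: h; move: (set_one T a); apply: ideal_gen_min => // _ [_ [C FC <-] ->].
by apply/(set_monomial_congr C hJ JT); apply: sub_adjoins; exact: mem_monomial_ideal.
Qed.

Lemma regular_seq_mod_monomial F (s : seq I) : uniq s ->
  regular_seq_mod (monomial_ideal F) [seq var i - 1 | i <- s].
Proof.
elim/last_ind: s => // s i IH; rewrite rcons_uniq => /andP[nsi us].
rewrite -cats1 map_cat; apply/regular_seq_mod_cat; split; first exact: IH.
split=> // a /adjoins_set_one; rewrite rmorphM rmorphB rmorph1 [X in X - 1]set_one_var.
by rewrite inE (negbTE nsi) => /regular_mod_monomial /adjoins_set_one.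
Qed.

End MonomialIdeals.

(** * Quotient rings and transfer of Cohen-Macaulayness *)

Section Quotients.
Local Open Scope classical_set_scope.
Local Open Scope ring_scope.
Local Open Scope quotient_scope.
Variables (A : comPzRingType) (I : ideal A).

Definition quo_pi (x : A) : quo I := \pi x.

Lemma quo_pi_is_additive : zmod_morphism quo_pi.
Proof.
by move=> x y; rewrite /quo_pi (quo_pi_add I) (quo_pi_opp I).
Qed.

Lemma quo_pi_is_multiplicative : monoid_morphism quo_pi.
Proof.
split=> [|x y]; last exact: (quo_pi_mul I).
by rewrite [RHS]/(quo_one I); unlock quo_one.
Qed.

HB.instance Definition _ := GRing.isZmodMorphism.Build A (quo I) quo_pi quo_pi_is_additive.
HB.instance Definition _ := GRing.isMonoidMorphism.Build A (quo I) quo_pi quo_pi_is_multiplicative.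

Lemma quo_pi_surj y : exists x, quo_pi x = y.
Proof. by exists (repr y); rewrite /quo_pi reprK. Qed.

Lemma quo_pi_eq0 x : quo_pi x = 0 <-> I x.
Proof.
rewrite -(rmorph0 quo_pi) /quo_pi; split=> [/eqP/quo_eqP|Ix].
  by rewrite subr0.
by apply/eqP/quo_eqP; rewrite subr0.
Qed.

Lemma quo_pi_ker : quo_pi @^-1` [set 0] = I.
Proof. by apply/seteqP; split=> x /quo_pi_eq0. Qed.

(* The proof argument is there for the canonical morphism structure. *)
Definition quo_lift (B : comPzRingType) (phi : {rmorphism A -> B})
  of (forall x, I x -> phi x = 0) := fun y : quo I => phi (repr y).

Section Lift.
Variables (B : comPzRingType) (phi : {rmorphism A -> B}).
Hypothesis phiI : forall x, I x -> phi x = 0.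

Lemma quo_lift_pi x : quo_lift phiI (quo_pi x) = phi x.
Proof. by apply/eqP; rewrite -subr_eq0 -rmorphB phiI //; exact: quo_repr. Qed.

Lemma quo_lift_is_additive : zmod_morphism (quo_lift phiI).
Proof.
move=> x y; have [a <-] := quo_pi_surj x; have [b <-] := quo_pi_surj y.
by rewrite -rmorphB !quo_lift_pi rmorphB.
Qed.

Lemma quo_lift_is_multiplicative : monoid_morphism (quo_lift phiI).
Proof.
split=> [|x y]; first by rewrite -(rmorph1 quo_pi) quo_lift_pi rmorph1.
have [a <-] := quo_pi_surj x; have [b <-] := quo_pi_surj y.
by rewrite -rmorphM !quo_lift_pi rmorphM.
Qed.

HB.instance Definition _ :=
  GRing.isZmodMorphism.Build (quo I) B (quo_lift phiI) quo_lift_is_additive.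
HB.instance Definition _ :=
  GRing.isMonoidMorphism.Build (quo I) B (quo_lift phiI) quo_lift_is_multiplicative.

End Lift.
End Quotients.

Section QuotientTransfer.
Local Open Scope classical_set_scope.
Local Open Scope ring_scope.

Theorem cohen_macaulay_quo_surj (A B : comPzRingType) (phi : {rmorphism A -> B})
    (I : ideal A) (fs : seq A) : (forall y, exists x, phi x = y) ->
  regular_seq_mod I fs -> phi @^-1` [set 0] = adjoins I fs ->
  cohen_macaulay I -> cohen_macaulay_ring B.
Proof.
move=> phi_surj rfs kerE cmI; have surjI := @quo_pi_surj _ I.
have phiI x : I x -> phi x = 0.
  move=> Ix; suff : (phi @^-1` [set 0]) x by [].
  by rewrite kerE; exact: sub_adjoins.
pose lift : {rmorphism quo I -> B} := quo_lift phiI.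
apply: (@cohen_macaulay_ring_surj (quo I) B lift (map (@quo_pi _ I) fs)) cmI.
- by move=> y; have [x <-] := phi_surj y; exists (quo_pi I x); exact: quo_lift_pi.
- by apply/regular_seq_mod_preimage => //; rewrite quo_pi_ker.
(* The two ideals of [quo I] are compared through their preimages in A. *)
- have preE : @quo_pi _ I @^-1` (lift @^-1` [set 0]) = adjoins I fs.
    by rewrite -kerE; apply/seteqP; split=> x; rewrite /preimage /= quo_lift_pi.
  apply/seteqP; split; apply: (preimage_surj_inj surjI);
    by rewrite preE preimage_adjoins // quo_pi_ker.
Qed.

Lemma cohen_macaulay_unit (A : comPzRingType) (I : ideal A) : I 1 -> cohen_macaulay I.
Proof.
move=> I1; have q0 (y : quo I) : y = 0.
  have [x <-] := quo_pi_surj y; apply/quo_pi_eq0.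
  by rewrite -[x]mulr1; apply: idealM.
split=> [J hJ|p].
  exists [::]; apply/seteqP; split=> y _; rewrite (q0 y); apply: is_ideal0 => //.
  exact: ideal_genP.
by case: (Defs.primeP p) => hp []; rewrite (q0 1); exact: is_ideal0.
Qed.

End QuotientTransfer.

(** * Specializing variables of a monomial ideal to 0 and 1 *)

Section MonomialTransfer.
Local Open Scope classical_set_scope.
Local Open Scope ring_scope.
Variables (k : fieldType) (I I' : finType) (v : I' -> I).
Variables (F : set {set I}) (F' : set {set I'}) (V : {set I}).
Hypothesis v_inj : injective v.

Let T : {set I} := [set i | (i \notin V) && (i \notin codom v)].

(** In the application [F] and [F'] are the maximal chains of P and P_S. The three conditions ensure
    that setting the variables of [T] to 1 turns the ideal of [F] into that of [F'] plus the
    variables of [V]. *)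
Hypothesis F'_lift : forall D, F' D -> exists2 C, F C & C :\: T = v @: D.
Hypothesis F_restr : forall C, F C ->
  (exists2 i, i \in C & (i \in V) && (i \notin codom v)) \/ exists2 D, F' D & v @: D \subset C.
Hypothesis V_isolated : forall i, i \in V -> exists2 C, F C & C :\: T = [set i]%SET.

(** The boolean cast sends the variables of [V] outside the image of [v] to 0 and those of [T] to
    1. *)
Let restr_var i : {mpoly k[#|I'|]} :=
  if [pick j | v j == i] is Some j then var k j else (i \notin V)%:R.
Let restr := subst restr_var.
Let incl : {mpoly k[#|I'|]} -> {mpoly k[#|I|]} := subst (fun j => var k (v j)).

HB.instance Definition _ := GRing.RMorphism.on restr.
HB.instance Definition _ := GRing.RMorphism.on incl.

Let restr_v j : restr_var (v j) = var k j.
Proof.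
by rewrite /restr_var; case: pickP => [j' /eqP/v_inj -> //|/(_ j)]; rewrite eqxx.
Qed.

Let restr_notv i : i \notin codom v -> restr_var i = (i \notin V)%:R.
Proof.
rewrite /restr_var; case: pickP => // j /eqP <-.
by rewrite codom_f.
Qed.

Let gen_monomial (J : finType) (G : set {set J}) : ideal {mpoly k[#|J|]} :=
  gen_ideal [set a | exists2 C, G C & a = set_monomial k C].

Let incl_monomial D : incl (set_monomial k D) = set_monomial k (v @: D).
Proof.
rewrite /set_monomial rmorph_prod big_imset /=; last by move=> x y _ _; exact: v_inj.
by apply: eq_bigr => j _; exact: subst_var.
Qed.

Let restr_incl b : restr (incl b) = b.
Proof.
have := @endo_congr_mod k I' [set 0] (GRing.RMorphism.clone _ _ (restr \o incl) _) b.
move=> h; apply/esym/eqP; rewrite -subr_eq0; apply/eqP; apply: h.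
- exact: is_ideal_zero.
- by move=> c /=; rewrite /restr /incl !subst_const.
by move=> j /=; rewrite /restr /incl !subst_var restr_v subrr.
Qed.

(** From right to left, generators are checked. From left to right, a is congruent to
    [incl (restr a)] modulo K: K contains x_i - 1 for i in [T], and x_i for i in [V] by
    [V_isolated]. *)
Let restr_kernel a : monomial_ideal F' (restr a) <->
  adjoins (monomial_ideal F) [seq var k i - 1 | i <- enum T] a.
Proof.
set K := adjoins _ _.
have hF := is_ideal_monomial k F; have hF' := is_ideal_monomial k F'.
have hK : is_ideal K by exact: is_ideal_adjoins.
have KT i : i \in T -> K (var k i - 1).
  move=> iT; apply: mem_adjoins => //.
  by apply: (map_f (fun i => var k i - 1)); rewrite mem_enum.
have KF C : F C -> K (set_monomial k (C :\: T)).
  move=> FC; apply/(set_monomial_congr C hK KT); apply: sub_adjoins.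
  exact: mem_monomial_ideal.
split=> [ha|]; last first.
  move: a; apply: (@adjoins_min _ _ (restr @^-1` monomial_ideal F')).
  - exact: (is_ideal_preimage restr).
  - apply: ideal_gen_min; first exact: (is_ideal_preimage restr).
    move=> _ [C FC ->]; rewrite /preimage /mkset /set_monomial rmorph_prod.
    have [[i iC /andP[iV iv]]|[D FD DC]] := F_restr FC.
      rewrite (bigD1 i) //= [X in X * _]subst_var restr_notv // iV mul0r.
      exact: is_ideal0.
    rewrite (big_setID (v @: D)) /= (finset.setIidPr DC); apply: is_idealMr => //.
    rewrite big_imset /=; last by move=> x y _ _; exact: v_inj.
    rewrite (eq_bigr (fun j => var k j)); first exact: mem_monomial_ideal.
    by move=> j _; rewrite [LHS]subst_var restr_v.
  - move=> _ /mapP[i + ->]; rewrite mem_enum inE => /andP[iV iv].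
    rewrite /preimage /mkset rmorphB rmorph1 [X in X - 1]subst_var restr_notv // iV subrr.
    exact: is_ideal0.
rewrite -(subrK (incl (restr a)) a); apply: is_idealD => //.
  apply: (@endo_congr_mod k I K (GRing.RMorphism.clone _ _ (incl \o restr) _) a hK).
    by move=> c /=; rewrite /restr /incl !subst_const.
  move=> i /=; rewrite /restr subst_var.
  have [/codomP[j ->]|iv] := boolP (i \in codom v).
    by rewrite restr_v /incl subst_var subrr; exact: is_ideal0.
  rewrite restr_notv // rmorph_nat; case: (boolP (i \in V)) => iV /=.
    rewrite subr0; have [C FC CT] := V_isolated iV.
    by have := KF C FC; rewrite CT /set_monomial big_set1.
  by apply: KT; rewrite inE iV iv.
move: ha; move: (restr a); apply: (@ideal_gen_min _ _ (incl @^-1` K)).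
  exact: (is_ideal_preimage incl).
move=> _ [D FD ->]; rewrite /preimage /mkset -/(set_monomial k D) incl_monomial.
by have [C FC <-] := F'_lift FD; exact: KF.
Qed.

Theorem cohen_macaulay_monomial_restr :
  cohen_macaulay (gen_monomial F) -> cohen_macaulay (gen_monomial F').
Proof.
apply: (@cohen_macaulay_quo_surj _ _
  (GRing.RMorphism.clone _ _ (@quo_pi _ (gen_monomial F') \o restr) _)
  (gen_monomial F) [seq var k i - 1 | i <- enum T]).
- move=> y; have [b <-] := quo_pi_surj y; exists (incl b) => /=.
  by rewrite restr_incl.
- by apply: regular_seq_mod_monomial; exact: enum_uniq.
- apply/seteqP; split=> a.
    by move=> /quo_pi_eq0 h; apply/restr_kernel.
  by move=> /restr_kernel h; apply/quo_pi_eq0.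
Qed.

End MonomialTransfer.

(** * Maximal chains and rank selection *)

Section Chains.
Context {d : Order.disp_t} {P : finPOrderType d}.
Implicit Types (C : {set P}) (p q x y z : P).

Lemma is_chainP C : reflect {in C &, forall x y, (x >=< y)%O} (is_chain C).
Proof.
apply: (iffP forall_inP) => [h x y xC yC|h x xC]; first by have /forall_inP := h x xC; exact.
by apply/forall_inP => y yC; exact: h.
Qed.

Lemma maximal_chainP C : is_maximal_chain C <->
  {in C &, forall x y, (x >=< y)%O} /\ forall x, {in C, forall y, (x >=< y)%O} -> x \in C.
Proof.
split=> [/maxsetP[/is_chainP chC maxC]|[chC maxC]].
  split=> // x xC; rewrite -(maxC (x |: C)) ?setU11 ?finset.subsetUr //.
  apply/is_chainP => y z; rewrite !inE => /orP[/eqP->|yC] /orP[/eqP->|zC].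
  - exact: comparablexx.
  - exact: xC.
  - by rewrite comparable_sym; exact: xC.
  - exact: chC.
apply/maxsetP; split; first exact/is_chainP.
move=> D /is_chainP chD CD; apply/eqP; rewrite finset.eqEsubset CD andbT.
by apply/fintype.subsetP => x xD; apply: maxC => y /(fintype.subsetP CD) yD; exact: chD.
Qed.

Lemma chain_sub_maximal C : is_chain C -> exists2 D, is_maximal_chain D & C \subset D.
Proof. by move=> /maxset_exists[D]; exists D. Qed.

Lemma is_chain1 p : is_chain [set p].
Proof. by apply/is_chainP => x y /set1P-> /set1P->; exact: comparablexx. Qed.

Lemma exists_covers p q : (p < q)%O -> exists2 z, covers z p & (z <= q)%O.
Proof.
have [n] := ubnP #|[set z | (p < z)%O && (z < q)%O]|.
elim: n q => // n IH q; rewrite ltnS => le_n pq.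
have [/forallP h|] := boolP [forall z, ~~ ((p < z)%O && (z < q)%O)]; first by exists q.
rewrite negb_forall => /existsP[z]; rewrite negbK => /andP[pz zq].
have [|w wp wz] := IH z _ pz.
- apply: leq_trans le_n; apply: proper_card; apply/fintype.properP; split.
    by apply/fintype.subsetP => x; rewrite !inE => /andP[-> xz]; exact: lt_trans zq.
  by exists z; rewrite !inE ?pz ?zq // ltxx andbF.
by exists w => //; apply: le_trans wz (ltW zq).
Qed.

Variable rk : P -> nat.
Hypothesis rkP : is_rank_function rk.

Lemma rank_lt p q : (p < q)%O -> rk p < rk q.
Proof.
have [n] := ubnP #|[set z | (p < z)%O && (z <= q)%O]|.
elim: n p => // n IH p; rewrite ltnS => le_n pq.
have [z zp zq] := exists_covers pq; have rkz := rkP.2 _ _ zp; have [pz _] := zp.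
move: zq; rewrite le_eqVlt => /orP[/eqP <-|zq]; first by rewrite rkz.
suff : rk z < rk q by rewrite rkz; lia.
apply: (IH z _ zq); apply: leq_trans le_n; apply: proper_card; apply/fintype.properP; split.
  by apply/fintype.subsetP => x; rewrite !inE => /andP[zx ->]; rewrite (lt_trans pz zx).
by exists z; rewrite !inE ?ltxx // pz ltW.
Qed.

Lemma rank_eq_comparable p q : (p >=< q)%O -> rk p = rk q -> p = q.
Proof. by move=> /comparable_ltgtP[/rank_lt|/rank_lt|//] + e; rewrite e ltnn. Qed.

Lemma rank_gt0 p : 0 < rk p.
Proof.
have [/forallP/(rkP.1 p) -> //|] := boolP [forall q, ~~ (q < p)%O].
by rewrite negb_forall => /existsP[q]; rewrite negbK => /rank_lt; lia.
Qed.

(** Some element of C lies below c, since otherwise anything below c could join C and c would be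
    minimal, of rank 1. The one of largest rank is covered by c, as an element strictly between
    could join C. *)
Lemma maximal_chain_rank_pred C c : is_maximal_chain C -> c \in C -> 1 < rk c ->
  exists2 b, b \in C & rk c = (rk b).+1.
Proof.
move=> /maximal_chainP[chC maxC] cC rc.
have [x0 /andP[x0C x0c]] : exists x, (x \in C) && (x < c)%O.
  apply/existsP; apply: contraLR rc; rewrite negb_exists => /forallP nlt.
  rewrite rkP.1 // => y; apply/negP => yc; have := nlt y; rewrite yc andbT => /negP; apply.
  apply: maxC => z zC; have := chC _ _ cC zC => /comparable_ltgtP[cz|zc|<-].
  - by rewrite /Order.comparable (ltW (lt_trans yc cz)).
  - by have := nlt z; rewrite zC zc.
  - by rewrite /Order.comparable (ltW yc).
have [b /andP[bC bc] bmax] := @arg_maxnP _ x0 (fun x => (x \in C) && (x < c)%O) rk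
  (introT andP (conj x0C x0c)).
exists b => //; apply: rkP.2; split=> // z; apply/negP => /andP[bz zc].
suff zC : z \in C by have := bmax z; rewrite zC zc => /(_ isT); have := rank_lt bz; lia.
apply: maxC => y yC; have := chC _ _ cC yC => /comparable_ltgtP[cy|yc|<-].
- by rewrite /Order.comparable (ltW (lt_trans zc cy)).
- have := chC _ _ bC yC => /comparable_ltgtP[byy|yb|<-].
  + by have := bmax y; rewrite yC yc => /(_ isT); have := rank_lt byy; lia.
  + by rewrite /Order.comparable (ltW (lt_trans yb bz)) orbT.
  + by rewrite /Order.comparable (ltW bz) orbT.
- by rewrite /Order.comparable (ltW zc).
Qed.

Lemma maximal_chain_rank C c j : is_maximal_chain C -> c \in C -> 0 < j <= rk c ->
  exists2 b, b \in C & rk b = j.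
Proof.
move=> mC; have [n] := ubnP (rk c); elim: n c => // n IH c; rewrite ltnS => le_n cC.
case/andP=> j0; rewrite leq_eqVlt => /orP[/eqP ->|jc]; first by exists c.
have [|b bC rb] := maximal_chain_rank_pred mC cC; first by lia.
by apply: (IH b) => //; lia.
Qed.

(** The point [p] guarantees that C is nonempty. *)
Lemma maximal_chain_top C p : is_maximal_chain C ->
  exists c, [/\ c \in C, maximal c & {in C, forall x, rk x <= rk c}].
Proof.
move=> /maximal_chainP[chC maxC].
have [C0|[x0 x0C]] := set_0Vmem C.
  by have : p \in C; [apply: maxC => y; rewrite C0 inE|rewrite C0 inE].
have [c cC cmax] := @arg_maxnP _ x0 (mem C) rk x0C.
exists c; split=> // y; apply/negP => cy.
have /cmax : y \in C.
  apply: maxC => z zC; have := chC _ _ cC zC => /comparable_ltgtP[cz|zc|<-].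
  - by have := cmax z zC; have := rank_lt cz; lia.
  - by rewrite /Order.comparable (ltW (lt_trans zc cy)) orbT.
  - by rewrite /Order.comparable (ltW cy) orbT.
by rewrite /=; have := rank_lt cy; lia.
Qed.

End Chains.

(** * Maximal chains of a rank-selected subposet *)

Section RankSelection.
Context {d : Order.disp_t} {P : finPOrderType d}.
Variables (k : fieldType) (rk : P -> nat) (S : {pred nat}).
Hypothesis rkP : is_rank_function rk.
Local Notation Q := (rank_selected rk S).
Implicit Types (p : P) (q : Q) (C : {set P}) (D : {set Q}).

Lemma comparable_val q q' : (\val q >=< \val q')%O = (q >=< q')%O.
Proof. by rewrite /Order.comparable !Order.le_val. Qed.

Lemma mem_codom_val p : (p \in codom (\val : Q -> P)) = (rk p \in S).
Proof.
apply/codomP/idP => [[q ->]|pS]; first exact: valP q.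
by exists (Sub p pS); rewrite SubK.
Qed.

(* Elements that end a maximal chain of P before it meets the selected ranks. *)
Let V : {set P} := [set p | [forall p', ~~ (p < p')%O] && [forall q : Q, rk p < rk (\val q)]].

(** The common consequence of the two cases of the theorem: it excludes a maximal chain stopping at
    an unselected rank strictly between selected ones. *)
Hypothesis maximal_rank : forall p, maximal p ->
  [\/ p \in V, rk p \in S | forall q : Q, rk (\val q) <= rk p].

Let V_unselected p : p \in V -> rk p \notin S.
Proof.
rewrite inE => /andP[_ /forallP h]; apply/negP => pS.
by have := h (Sub p pS); rewrite SubK ltnn.
Qed.

(** Extend D to a maximal chain C of P. Selected elements of C are comparable to all of D, hence lie
    in D. An element of [V] in C would be comparable to some d0 in D and of smaller rank, hence
    below it, though maximal. *)
Let selected_chain_lift (q0 : Q) D : is_maximal_chain D -> exists2 C, is_maximal_chain C &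
  C :\: [set p | (p \notin V) && (p \notin codom (\val : Q -> P))] = \val @: D.
Proof.
move=> mD; have /maximal_chainP[chD maxD] := mD.
have [C mC DC] : exists2 C, is_maximal_chain C & \val @: D \subset C.
  apply: chain_sub_maximal; apply/is_chainP => _ _ /imsetP[x xD ->] /imsetP[y yD ->].
  by rewrite comparable_val; exact: chD.
have [D0|[d0 d0D]] := set_0Vmem D.
  by have : q0 \in D; [apply: maxD => y; rewrite D0 inE|rewrite D0 inE].
exists C => //; have /maximal_chainP[chC _] := mC.
apply/setP => p; rewrite finset.in_setD finset.in_set negb_and !negbK.
apply/andP/idP => [[/orP[pV|/codomP[q pE]] pC]|pD]; last first.
- split; last exact: (fintype.subsetP DC).
  by have /imsetP[q _ ->] := pD; rewrite codom_f orbT.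
- rewrite pE; apply: imset_f; apply: maxD => y yD; rewrite -comparable_val -pE.
  by apply: chC => //; apply: (fintype.subsetP DC); exact: imset_f.
move: pV; rewrite finset.in_set => /andP[/forallP pmax /forallP/(_ d0) ltpd].
have d0C : \val d0 \in C by apply: (fintype.subsetP DC); exact: imset_f.
have := chC _ _ pC d0C => /comparable_ltgtP[h|/(rank_lt rkP) h|h].
- by have := pmax (\val d0); rewrite h.
- by have := ltn_trans ltpd h; rewrite ltnn.
- by move: ltpd; rewrite h ltnn.
Qed.

(** Let c be the top of C, not in [V], and z selected and comparable to the selected part of C. If z
    has rank at most that of c, then C has an element of the same rank, which equals z. Otherwise c
    must be selected, so c is below z, contradicting its maximality. *)
Let chain_restr (q0 : Q) C : is_maximal_chain C ->
  (exists2 p, p \in C & (p \in V) && (p \notin codom (\val : Q -> P))) \/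
  exists2 D : {set Q}, is_maximal_chain D & \val @: D \subset C.
Proof.
move=> mC; have [c [cC cmax rkc]] := maximal_chain_top rkP (\val q0) mC.
have /maximal_chainP[chC maxC] := mC.
have [pV|h] : c \in V \/ (rk c \in S \/ forall q : Q, rk (\val q) <= rk c).
  by case: (maximal_rank cmax); [left|right; left|right; right].
  by left; exists c; rewrite // pV mem_codom_val V_unselected.
right; exists [set q : Q | \val q \in C]; last first.
  by apply/fintype.subsetP => _ /imsetP[q + ->]; rewrite finset.in_set.
apply/maximal_chainP; split=> [x y|z hz]; rewrite ?finset.in_set.
  by move=> xC yC; rewrite -comparable_val; exact: chC.
have {}hz p : p \in C -> rk p \in S -> (\val z >=< p)%O.
  move=> pC pS; have pE : \val (Sub p pS : Q) = p by rewrite SubK.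
  by rewrite -pE comparable_val; apply: hz; rewrite finset.in_set pE.
have [zc|cz] := leqP (rk (\val z)) (rk c).
  have [|b bC bz] := @maximal_chain_rank _ _ _ rkP C c (rk (\val z)) mC cC.
    by rewrite rank_gt0.
  rewrite (rank_eq_comparable rkP (p := \val z) (q := b)) //; apply: hz => //.
  by rewrite bz; exact: valP z.
case: h => [cS|/(_ z)]; last by rewrite leqNgt cz.
have := hz c cC cS => /comparable_ltgtP[/(rank_lt rkP) h|h|-> //].
  by have := ltn_trans cz h; rewrite ltnn.
by have := cmax (\val z); rewrite h.
Qed.

(** In a maximal chain through p every other element is below p: it is not maximal, hence not in
    [V], and its rank is below all selected ranks. *)
Let V_chain p : p \in V -> exists2 C, is_maximal_chain C &
  C :\: [set p | (p \notin V) && (p \notin codom (\val : Q -> P))] = [set p].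
Proof.
move=> pV; have [C mC pC] := chain_sub_maximal (is_chain1 p).
exists C => //; have /maximal_chainP[chC _] := mC; rewrite finset.sub1set in pC.
apply/setP => p'; rewrite finset.in_setD finset.in_set negb_and !negbK finset.in_set1.
apply/andP/eqP => [[h p'C]|->]; last by rewrite pV.
have := pV; rewrite finset.in_set => /andP[/forallP pmax /forallP pltq].
apply/esym; have := chC _ _ pC p'C => /comparable_ltgtP[lt|lt|//].
  by have := pmax p'; rewrite lt.
move: h; rewrite finset.in_set mem_codom_val => /orP[/andP[/forallP/(_ p)]|p'S]; first by rewrite lt.
by have := pltq (Sub p' p'S); rewrite SubK; have := rank_lt rkP lt; lia.
Qed.

Theorem cohen_macaulay_rank_selected :
  cohen_macaulay (flag_ideal k P) -> cohen_macaulay (partial_flag_ideal k rk S).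
Proof.
move=> cmP; have [/existsP[q0 _]|] := boolP [exists q : Q, true].
  apply: (@cohen_macaulay_monomial_restr k P Q \val (fun C => is_maximal_chain C)
    (fun D => is_maximal_chain D) V) cmP.
  - exact: val_inj.
  - exact: selected_chain_lift q0.
  - exact: chain_restr q0.
  - exact: V_chain.
(* With no selected element the empty set is a maximal chain and its monomial is 1. *)
rewrite negb_exists => /forallP Q0; apply: cohen_macaulay_unit.
apply: ideal_gen_incl; exists finset.set0.
  by apply/maximal_chainP; split=> x; [rewrite finset.in_set0|have := Q0 x].
by rewrite /chain_monomial big_set0.
Qed.

End RankSelection.

Theorem lemma4p3 (k : fieldType) (d : Order.disp_t) (P : finPOrderType d)
    (rk : P -> nat) (r : nat) :
  poset_rank rk = r ->
  cohen_macaulay (flag_ideal k P) ->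
  (is_rank_function rk ->
    forall i j : nat,
      {subset [pred s | i <= s <= i + j] <= [pred s | 1 <= s <= r]} ->
      cohen_macaulay (partial_flag_ideal k rk [pred s | i <= s <= i + j])) /\
  (is_pure rk ->
    forall S : {pred nat},
      {subset S <= [pred s | 1 <= s <= r]} ->
      cohen_macaulay (partial_flag_ideal k rk S)).
Proof.
move=> _ cmP; split=> [rkP i j _|[rkP pure] S _];
  apply: cohen_macaulay_rank_selected => // p pmax.
  (* For an interval, the rank of p is below it, inside it or above it, matching the three
     alternatives. *)
  have [pi|ip] := ltnP (rk p) i.
    constructor 1; rewrite inE; apply/andP; split; apply/forallP => //.
    by move=> q; have := valP q; rewrite inE => /andP[iq _]; exact: leq_trans iq.
  have [pij|ijp] := leqP (rk p) (i + j); first by constructor 2; rewrite inE ip.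
  constructor 3 => q; have := valP q; rewrite inE => /andP[_ qij].
  exact: leq_trans qij (ltnW ijp).
(* By purity p has the rank of the top of a maximal chain through q, hence at least the rank of
   q. *)
constructor 3 => q; have [C mC qC] := chain_sub_maximal (is_chain1 (\val q)).
have [c [_ cmax le_c]] := maximal_chain_top rkP p mC.
by rewrite (pure p c pmax cmax); apply: le_c; rewrite -finset.sub1set.
Qed.
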